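(* For every integer $q\geq 1$, writing $\mathbf{S}_p:=\sum_{n\ge1}\frac{\binom{2n}{n}}{4^nn^p}$, $\mathbf{S}_{1,p}:=\sum_{n\ge1}\frac{H_n\binom{2n}{n}}{4^nn^p}$ and $\tilde{\mathbf{S}}_p:=\sum_{n\ge1}\frac{4^n}{n^p\binom{2n}{n}}$, we have \begin{align*} \sum_{n=1}^{\infty}\frac{H_{2n}\binom{2n}{n}}{4^nn^q} &=\ln(2)\mathbf{S}_q+\frac{q}{2}\mathbf{S}_{q+1}+\mathbf{S}_{1,q}+\frac{(-1)^q}{2}\tilde{\mathbf{S}}_{q+1} -\frac{1}{2}\sum_{k_1+k_2+k_3+k_4=q+1}H(k_1,k_2,k_3,k_4)\\ &\quad+2\sum_{k_1+k_2+k_3+k_4+2k_5=q-1}H(k_1,k_2,k_3,k_4)\zeta(2k_5+2)\\ &\quad-2\sum_{k_1+k_2+k_3+k_4+2k_5+2k_6=q-3}H(k_1,k_2,k_3,k_4)\zeta(2k_5+2)\zeta(2k_6+2)\,, \end{align*} where all $k_i$ range over nonnegative integers (an empty sum is $0$).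
   Context: $H_n=\sum_{k=1}^n1/k$. $H(k_1,k_2,k_3,k_4):=\frac{(-1)^{k_4}2^{k_1+k_4}\ln^{k_4}(2)\,C_{k_1}D_{k_2}D_{k_3}}{k_1!k_2!k_3!k_4!}$, where, with the exponential complete Bell polynomials $Y_n$ defined by $\exp\left(\sum_{k\geq1}x_k\frac{t^k}{k!}\right)=\sum_{n\geq0}Y_n(x_1,\ldots,x_n)\frac{t^n}{n!}$, $C_n=Y_n(x_1,\dots,x_n)$ with $x_1=0$, $x_j=(-1)^j(j-1)!\zeta(j)$ ($j\ge2$), and $D_n=Y_n(x_1,\dots,x_n)$ with $x_1=0$, $x_j=(-1)^{j-1}(j-1)!\zeta(j)$ ($j\ge2$). *)

(* Defs.v *)
From Stdlib Require Import Reals Lra Lia Arith.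
From Coquelicot Require Import Coquelicot.
Open Scope R_scope.

Definition harmonic (n : nat) : R := sum_n_m (fun k => / INR k) 1 n.

(* [Binomial.C] is the real-valued binomial coefficient; the bare name [C] is
   Coquelicot's type of complex numbers. *)
Definition central_binom (n : nat) : R := Binomial.C (2 * n) n.

(* Coquelicot's [Series] starts at index 0, hence the shift. *)
Definition Series1 (u : nat -> R) : R := Series (fun n => u (S n)).
Definition is_series1 (u : nat -> R) (l : R) : Prop :=
  is_series (fun n => u (S n)) l.

Definition zeta (s : nat) : R := Series1 (fun n => / INR n ^ s).

Fixpoint PS_pow (a : nat -> R) (m n : nat) : R :=
  match m with
  | O => if (n =? 0)%nat then 1 else 0
  | S m' => PS_mult a (PS_pow a m') n
  end.

(* Coefficients of sum_(k >= 1) x_k t^k / k!; the value [x 0] is not used. *)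
Definition bell_arg (x : nat -> R) (k : nat) : R :=
  if (k =? 0)%nat then 0 else x k / INR (fact k).

Lemma PS_pow_bell_arg_low (x : nat -> R) (m n : nat) :
  (n < m)%nat -> PS_pow (bell_arg x) m n = 0.
Proof.
revert n; induction m as [|m IH]; intros n Hn; [lia|].
simpl; unfold PS_mult.
rewrite (sum_eq _ (fun _ => 0)).
- rewrite sum_cte; ring.
- intros [|i] Hi.
  + unfold bell_arg; simpl; ring.
  + rewrite IH by lia; ring.
Qed.

(* The exponential of a formal power series g with zero constant term is
   sum_m g^m / m!, and bellY x n / n! is its coefficient of t^n. The terms with
   m > n contribute nothing to it, by [PS_pow_bell_arg_low]. *)
Definition bellY (x : nat -> R) (n : nat) : R :=
  INR (fact n) *
  sum_n (fun m => PS_pow (bell_arg x) m n / INR (fact m)) n.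

Definition Cseq (n : nat) : R :=
  bellY (fun j => if (j <=? 1)%nat then 0
                  else (-1) ^ j * INR (fact (j - 1)) * zeta j) n.

Definition Dseq (n : nat) : R :=
  bellY (fun j => if (j <=? 1)%nat then 0
                  else (-1) ^ (j - 1) * INR (fact (j - 1)) * zeta j) n.

Definition Hcoef (k1 k2 k3 k4 : nat) : R :=
  (-1) ^ k4 * 2 ^ (k1 + k4) * ln 2 ^ k4 * Cseq k1 * Dseq k2 * Dseq k3
  / (INR (fact k1) * INR (fact k2) * INR (fact k3) * INR (fact k4)).

Definition bS (p : nat) : R :=
  Series1 (fun n => central_binom n / (4 ^ n * INR n ^ p)).

Definition bS1 (p : nat) : R :=
  Series1 (fun n => harmonic n * central_binom n / (4 ^ n * INR n ^ p)).

Definition bSt (p : nat) : R :=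
  Series1 (fun n => 4 ^ n / (INR n ^ p * central_binom n)).

(* Sums over tuples of naturals satisfying [cond], each component at most [N].
   They are used with conditions that force this bound on the components. *)
Definition sum4 (N : nat) (cond : nat -> nat -> nat -> nat -> bool)
    (f : nat -> nat -> nat -> nat -> R) : R :=
  sum_n (fun k1 => sum_n (fun k2 => sum_n (fun k3 => sum_n (fun k4 =>
    if cond k1 k2 k3 k4 then f k1 k2 k3 k4 else 0) N) N) N) N.

Definition sum5 (N : nat) (cond : nat -> nat -> nat -> nat -> nat -> bool)
    (f : nat -> nat -> nat -> nat -> nat -> R) : R :=
  sum_n (fun k5 => sum4 N (fun k1 k2 k3 k4 => cond k1 k2 k3 k4 k5)
                          (fun k1 k2 k3 k4 => f k1 k2 k3 k4 k5)) N.

Definition sum6 (N : nat) (cond : nat -> nat -> nat -> nat -> nat -> nat -> bool)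
    (f : nat -> nat -> nat -> nat -> nat -> nat -> R) : R :=
  sum_n (fun k6 => sum5 N (fun k1 k2 k3 k4 k5 => cond k1 k2 k3 k4 k5 k6)
                          (fun k1 k2 k3 k4 k5 => f k1 k2 k3 k4 k5 k6)) N.

(* Main.v *)
(* Let B(s) = Gamma(1 + 2s) / (Gamma(1 + s)^2 4^s), so that B(n) = C(2n,n)/4^n,
   and W(s) = pi s cot(pi s) = 1 - 2 sum_k zeta(2k) s^(2k).  The sums over tuples
   add up to -1/2 times the coefficient of s^(q+1) in B W^2, and the theorem says
   that the residues of B(s) (pi cot(pi s))^2 / s^q add up to 0.

   The argument avoids complex analysis.  Put b_k = C(2k,k)/4^k and
   P(s) = 1 - sum_(j >= 1) bS(j) s^j.  A telescoping recurrence for the Taylor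
   coefficients of (x + N) sum_k b_k / (k + x + N), whose limit for N -> oo is
   trivial after normalisation, gives P(-s) B(s) = 1.  Expanding P(s) P(-s) as a
   double series gives P(s) P(-s) = W(s), hence B W = P and B W^2 = W P.  Finally
   B'(n) = 2 b_n (H_(2n) - H_n - ln 2) = sum_(k <> n) b_k / (n - k) and
   1 / (n b_n) = sum_k b_k / (n + k); inserting these and exchanging the order of
   summation expresses sum_n B'(n) / n^q by the coefficient of s^(q+1) in W P. *)

Require Import Defs.
From Stdlib Require Import Reals Lra Lia Arith FunctionalExtensionality.
From Coquelicot Require Import Coquelicot.
Open Scope R_scope.

(** * Formal power series *)

(** The Bell polynomials encode exponentials, so the series built from them are handled through
    their logarithmic derivatives: [theta a = fps_mul p a] with constant term 1 determines [a].
    Iterating the recurrence produces finite products whose logarithmic derivatives consist of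
    partial zeta sums and of H_(2N) - H_N; their limits are those of B. Gamma and the cotangent thus
    enter only through coefficients. In the residue picture, n > 0 contributes B'(n) / n^q - q b_n /
    n^(q+1), and -n contributes B'(-n) / (-n)^q with B'(-n) = -1 / (n b_n); hence the terms in
    [bS (q + 1)] and [bSt (q + 1)]. In the proof, the former comes from the diagonal k = n, which
    the sums over k <> n leave out. The delicate point is the last exchange of summations: the terms
    have both signs, and for q = 1 the sum over n of their absolute values is of order b_k H_k / k,
    so the majorant has to keep the logarithm. *)

Definition fps0 : nat -> R := fun _ => 0.
Definition fps1 : nat -> R := fun n => if (n =? 0)%nat then 1 else 0.
Definition fps_opp (a : nat -> R) : nat -> R := fun n => - a n.
Definition fps_add (a b : nat -> R) : nat -> R := fun n => a n + b n.
Definition fps_sub (a b : nat -> R) : nat -> R := fun n => a n - b n.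
Definition fps_mul (a b : nat -> R) : nat -> R := fun n => PS_mult a b n.
Definition fps_tail (a : nat -> R) : nat -> R := fun n => a (S n).

Lemma fps_mul_0 a b : fps_mul a b 0 = a 0%nat * b 0%nat.
Proof. reflexivity. Qed.

(** Peeling a term off either end of the Cauchy product reduces commutativity and associativity to
    inductions on the degree. *)
Lemma fps_mul_Sl a b n :
  fps_mul a b (S n) = a 0%nat * b (S n) + fps_mul (fps_tail a) b n.
Proof.
unfold fps_mul, PS_mult, fps_tail.
rewrite decomp_sum by lia; simpl pred.
replace (S n - 0)%nat with (S n) by lia; f_equal.
Qed.

Lemma fps_mul_Sr a b n :
  fps_mul a b (S n) = a (S n) * b 0%nat + fps_mul a (fps_tail b) n.
Proof.
unfold fps_mul, PS_mult, fps_tail.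
rewrite tech5, Nat.sub_diag, Rplus_comm; f_equal.
apply sum_eq; intros i Hi; f_equal; f_equal; lia.
Qed.

Lemma fps_mul_comm a b : fps_mul a b = fps_mul b a.
Proof.
extensionality n; revert a b; induction n as [|n IH]; intros a b.
- rewrite !fps_mul_0; ring.
- rewrite fps_mul_Sl, fps_mul_Sr, IH; ring.
Qed.

Lemma fps_mul_add_l a b c :
  fps_mul (fps_add a b) c = fps_add (fps_mul a c) (fps_mul b c).
Proof.
extensionality n; unfold fps_mul, fps_add, PS_mult.
rewrite <- sum_plus; apply sum_eq; intros; ring.
Qed.

Lemma fps_mul_scal_l x a b :
  fps_mul (fun n => x * a n) b = (fun n => x * fps_mul a b n).
Proof.
extensionality n; unfold fps_mul, PS_mult.
rewrite scal_sum; apply sum_eq; intros; ring.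
Qed.

Lemma fps_mul_assoc a b c : fps_mul a (fps_mul b c) = fps_mul (fps_mul a b) c.
Proof.
extensionality n; revert a b c; induction n as [|n IH]; intros a b c.
- rewrite !fps_mul_0; ring.
- rewrite (fps_mul_Sl a), (fps_mul_Sl (fps_mul a b)), fps_mul_0, IH, (fps_mul_Sl b).
  replace (fps_tail (fps_mul a b)) with
    (fps_add (fun n => a 0%nat * fps_tail b n) (fps_mul (fps_tail a) b)).
  + rewrite fps_mul_add_l, fps_mul_scal_l; unfold fps_add; ring.
  + extensionality k; unfold fps_add, fps_tail at 3; rewrite fps_mul_Sl; reflexivity.
Qed.

Lemma fps_mul_1_l a : fps_mul fps1 a = a.
Proof.
extensionality n; destruct n as [|n].
- rewrite fps_mul_0; unfold fps1; simpl; ring.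
- rewrite fps_mul_Sl; unfold fps_mul, PS_mult, fps_tail, fps1; simpl.
  rewrite (sum_eq _ (fun _ => 0)) by (intros; ring).
  rewrite sum_cte; ring.
Qed.

Lemma fps_ring_theory :
  ring_theory fps0 fps1 fps_add fps_mul fps_sub fps_opp (@eq (nat -> R)).
Proof.
constructor; intros; try (extensionality n; unfold fps_add, fps0, fps_sub, fps_opp; ring).
- apply fps_mul_1_l.
- apply fps_mul_comm.
- apply fps_mul_assoc.
- apply fps_mul_add_l.
Qed.

Add Ring fps_ring : fps_ring_theory.

(** * The operator x d/dx and logarithmic derivatives *)

Definition theta (a : nat -> R) : nat -> R := fun n => INR n * a n.

Lemma theta_mul a b :
  theta (fps_mul a b) = fps_add (fps_mul (theta a) b) (fps_mul a (theta b)).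
Proof.
extensionality n; unfold theta, fps_add, fps_mul, PS_mult.
rewrite scal_sum, <- sum_plus; apply sum_eq; intros i Hi.
rewrite (minus_INR n i) by lia; ring.
Qed.

Lemma theta_mul_log a b p r :
  theta a = fps_mul p a -> theta b = fps_mul r b ->
  theta (fps_mul a b) = fps_mul (fps_add p r) (fps_mul a b).
Proof. intros Ha Hb; rewrite theta_mul, Ha, Hb; ring. Qed.

(** In degree n + 1 the equation [theta c = fps_mul s c] with s_0 = 0 expresses (n + 1) c_(n+1) as a
    finite sum of products s_(i+1) c_(n-i). Limits therefore pass from the logarithmic derivatives
    to the series by strong induction on the degree. *)
Lemma theta_eq_lim (a p : nat -> nat -> R) (b r : nat -> R) :
  (forall N, theta (a N) = fps_mul (p N) (a N)) ->
  theta b = fps_mul r b ->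
  (forall N, a N 0%nat = 1) -> b 0%nat = 1 ->
  (forall N, p N 0%nat = 0) -> r 0%nat = 0 ->
  (forall j, is_lim_seq (fun N => p N j) (r j)) ->
  forall n, is_lim_seq (fun N => a N n) (b n).
Proof.
intros Ha Hb Ha0 Hb0 Hp0 Hr0 Hlim n.
induction n as [n IH] using lt_wf_ind.
destruct n as [|n].
- rewrite Hb0; apply is_lim_seq_ext with (fun _ => 1).
  + intros N; now rewrite Ha0.
  + apply is_lim_seq_const.
- assert (E : forall c s : nat -> R, s 0%nat = 0 -> theta c = fps_mul s c ->
     c (S n) = / INR (S n) * sum_f_R0 (fun i => s (S i) * c (n - i)%nat) n).
  { intros c s Hs Hc.
    assert (H : theta c (S n) = fps_mul s c (S n)) by now rewrite Hc.
    rewrite fps_mul_Sl, Hs, Rmult_0_l, Rplus_0_l in H.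
    unfold fps_mul, PS_mult, fps_tail, theta in H; rewrite <- H.
    field; apply not_0_INR; lia. }
  rewrite (E b r Hr0 Hb).
  apply is_lim_seq_ext with
    (fun N => / INR (S n) * sum_f_R0 (fun i => p N (S i) * a N (n - i)%nat) n).
  + intros N; symmetry; now apply E.
  + apply (is_lim_seq_scal_l _ (/ INR (S n))
      (Finite (sum_f_R0 (fun i => r (S i) * b (n - i)%nat) n))).
    assert (G : forall m, (m <= n)%nat ->
      is_lim_seq (fun N => sum_f_R0 (fun i => p N (S i) * a N (n - i)%nat) m)
                 (sum_f_R0 (fun i => r (S i) * b (n - i)%nat) m)).
    { induction m as [|m IHm]; intros Hm; simpl sum_f_R0.
      - apply is_lim_seq_mult'; [apply Hlim | apply IH; lia].
      - apply is_lim_seq_plus'; [apply IHm; lia|].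
        apply is_lim_seq_mult'; [apply Hlim | apply IH; lia]. }
    now apply G.
Qed.

Definition fps_scale (c : R) (a : nat -> R) : nat -> R := fun n => c ^ n * a n.

Lemma fps_scale_mul c a b :
  fps_scale c (fps_mul a b) = fps_mul (fps_scale c a) (fps_scale c b).
Proof.
extensionality n; unfold fps_scale, fps_mul, PS_mult.
rewrite scal_sum; apply sum_eq; intros i Hi.
replace (c ^ n) with (c ^ i * c ^ (n - i)).
- ring.
- rewrite <- pow_add; f_equal; lia.
Qed.

Lemma theta_scale c a : theta (fps_scale c a) = fps_scale c (theta a).
Proof. extensionality n; unfold theta, fps_scale; ring. Qed.

Lemma theta_scale_log c a p :
  theta a = fps_mul p a -> theta (fps_scale c a) = fps_mul (fps_scale c p) (fps_scale c a).
Proof. intros H; now rewrite theta_scale, H, fps_scale_mul. Qed.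

Lemma PS_pow_S a m : PS_pow a (S m) = fps_mul a (PS_pow a m).
Proof. reflexivity. Qed.

Lemma theta_PS_pow a m :
  theta (PS_pow a (S m)) = (fun n => INR (S m) * fps_mul (theta a) (PS_pow a m) n).
Proof.
induction m as [|m IH].
- replace (PS_pow a 0) with fps1 by reflexivity.
  rewrite PS_pow_S; replace (PS_pow a 0) with fps1 by reflexivity.
  replace (fps_mul a fps1) with a by ring.
  replace (fps_mul (theta a) fps1) with (theta a) by ring.
  extensionality n; simpl; ring.
- rewrite PS_pow_S, theta_mul, IH.
  rewrite (fps_mul_comm a), fps_mul_scal_l.
  replace (fps_mul (fps_mul (theta a) (PS_pow a m)) a)
    with (fps_mul (theta a) (PS_pow a (S m))) by (rewrite PS_pow_S; ring).
  extensionality n; unfold fps_add; rewrite (S_INR (S m)); ring.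
Qed.

(** * Bell polynomials as coefficients of a formal exponential *)

Definition bell_egf (x : nat -> R) : nat -> R := fun n => bellY x n / INR (fact n).

(** The extra powers start above degree n. A cut-off common to several coefficients is what makes a
    Cauchy product with [bell_egf x] computable term by term. *)
Lemma bell_egf_sum x n M : (n <= M)%nat ->
  bell_egf x n = sum_n (fun m => PS_pow (bell_arg x) m n / INR (fact m)) M.
Proof.
intros H; unfold bell_egf, bellY.
replace M with (n + (M - n))%nat by lia.
induction (M - n)%nat as [|d IH].
- rewrite Nat.add_0_r; field; apply INR_fact_neq_0.
- rewrite Nat.add_succ_r, sum_Sn, <- IH, PS_pow_bell_arg_low by lia.
  unfold plus; simpl; unfold Rdiv; ring.
Qed.

Lemma bell_egf_0 x : bell_egf x 0 = 1.
Proof.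
unfold bell_egf, bellY; rewrite sum_O; simpl; field.
Qed.

Lemma fps_mul_sum_n a (u : nat -> nat -> R) M n :
  fps_mul a (fun k => sum_n (fun m => u m k) M) n = sum_n (fun m => fps_mul a (u m) n) M.
Proof.
induction M as [|M IH].
- rewrite sum_O; f_equal; extensionality k; now rewrite sum_O.
- rewrite sum_Sn, <- IH.
  replace (fun k => sum_n (fun m => u m k) (S M))
    with (fps_add (fun k => sum_n (fun m => u m k) M) (u (S M)))
    by (extensionality k; unfold fps_add; rewrite sum_Sn; reflexivity).
  rewrite fps_mul_comm, fps_mul_add_l, !(fps_mul_comm _ a); reflexivity.
Qed.

Lemma fps_mul_ext_le a b b' n :
  (forall k, (k <= n)%nat -> b k = b' k) -> fps_mul a b n = fps_mul a b' n.
Proof.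
intros H; unfold fps_mul, PS_mult; apply sum_eq; intros i Hi.
rewrite H by lia; reflexivity.
Qed.

Lemma sum_n_Sl (f : nat -> R) n :
  sum_n f (S n) = f 0%nat + sum_n (fun k => f (S k)) n.
Proof.
induction n as [|n IH]; [rewrite sum_Sn, !sum_O; reflexivity|].
rewrite sum_Sn, IH, sum_Sn; unfold plus; simpl; ring.
Qed.

(** The derivative of exp(g), taken termwise: [theta] of g^(m+1) / (m+1)! is [theta g] times g^m /
    m!. *)
Lemma theta_bell_egf x :
  theta (bell_egf x) = fps_mul (theta (bell_arg x)) (bell_egf x).
Proof.
extensionality n.
rewrite (fps_mul_ext_le _ _ (fun k => sum_n (fun m => / INR (fact m) * PS_pow (bell_arg x) m k) n)).
2:{ intros k Hk; rewrite (bell_egf_sum x k n Hk); apply sum_n_ext; intros m; apply Rmult_comm. }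
rewrite (fps_mul_sum_n _ (fun m k => / INR (fact m) * PS_pow (bell_arg x) m k)).
(* The cut-off n + 1 allows for the shift from m to m + 1. The term m = 0 lives in degree 0 only,
   where [theta] multiplies by 0. *)
unfold theta at 1; rewrite (bell_egf_sum x n (S n)) by lia.
rewrite sum_n_Sl, Rmult_plus_distr_l.
replace (INR n * (PS_pow (bell_arg x) 0 n / INR (fact 0))) with 0
  by (destruct n; simpl; field).
rewrite Rplus_0_l.
change (INR n * ?u) with (mult (INR n) u).
rewrite <- (sum_n_mult_l (K := R_Ring)).
apply sum_n_ext; intros m.
rewrite (fps_mul_comm _ (fun k => _)), fps_mul_scal_l, fps_mul_comm.
pose proof (equal_f (theta_PS_pow (bell_arg x) m) n) as H.
change (INR n * PS_pow (bell_arg x) (S m) n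
        = INR (S m) * fps_mul (theta (bell_arg x)) (PS_pow (bell_arg x) m) n) in H.
change (INR n * (PS_pow (bell_arg x) (S m) n / INR (fact (S m)))
        = / INR (fact m) * fps_mul (theta (bell_arg x)) (PS_pow (bell_arg x) m) n).
unfold Rdiv; rewrite <- Rmult_assoc, H, fact_simpl, mult_INR.
field; split; [apply INR_fact_neq_0 | apply not_0_INR; lia].
Qed.

(** * The numbers C(2k,k)/4^k and their Stieltjes transform *)

Definition beta (n : nat) : R := central_binom n / 4 ^ n.

Lemma beta_0 : beta 0 = 1.
Proof. unfold beta, central_binom, Binomial.C; simpl; field. Qed.

Lemma beta_S n : INR (S n) * beta (S n) = (INR n + / 2) * beta n.
Proof.
unfold beta, central_binom, Binomial.C.
replace (2 * S n - S n)%nat with (S n) by lia.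
replace (2 * n - n)%nat with n by lia.
replace (2 * S n)%nat with (S (S (2 * n))) by lia.
rewrite !fact_simpl, !mult_INR, !S_INR, mult_INR; simpl (INR 2); simpl pow.
pose proof (INR_fact_neq_0 n); pose proof (pos_INR n).
field; repeat split; try lra; apply pow_nonzero; lra.
Qed.

Lemma beta_S_div n : beta (S n) = (INR n + / 2) / INR (S n) * beta n.
Proof.
assert (INR (S n) <> 0) by (apply not_0_INR; lia).
apply Rmult_eq_reg_l with (INR (S n)); [|assumption].
rewrite beta_S; field; assumption.
Qed.

Lemma beta_pos n : 0 < beta n.
Proof.
induction n as [|n IH]; [rewrite beta_0; lra|].
rewrite beta_S_div; apply Rmult_lt_0_compat; [|assumption].
pose proof (pos_INR n); apply Rdiv_lt_0_compat; [lra|apply lt_0_INR; lia].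
Qed.

(** The weight 2n + 1 makes the left side nonincreasing, since (x + 1/2)^2 (2x + 3) <= (x + 1)^2 (2x
    + 1). It forces [beta] to tend to 0. *)
Lemma beta_sq_le n : beta n ^ 2 * (2 * INR n + 1) <= 1.
Proof.
induction n as [|n IH]; [rewrite beta_0; simpl; lra|].
rewrite beta_S_div, S_INR; pose proof (pos_INR n); pose proof (pow2_ge_0 (beta n)).
set (x := INR n) in *.
replace (((x + / 2) / (x + 1) * beta n) ^ 2 * (2 * (x + 1) + 1))
  with (beta n ^ 2 * ((x + / 2) ^ 2 * (2 * x + 3) / (x + 1) ^ 2)) by (field; lra).
refine (Rle_trans _ _ _ _ IH); apply Rmult_le_compat_l; [assumption|].
apply Rle_div_l; [apply pow_lt; lra|]; nra.
Qed.

Lemma is_lim_seq_inv_affine a : 0 < a -> is_lim_seq (fun n => / (a * INR n + 1)) 0.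
Proof.
intros Ha.
replace (Finite 0) with (Rbar_inv p_infty) by reflexivity.
apply is_lim_seq_inv; [|easy].
apply is_lim_seq_plus with p_infty 1; [|apply is_lim_seq_const|reflexivity].
replace p_infty with (Rbar_mult a p_infty).
- apply is_lim_seq_scal_l, is_lim_seq_INR.
- simpl; destruct (Rle_dec 0 a); [|lra]; destruct (Rle_lt_or_eq_dec 0 a r); [reflexivity|lra].
Qed.

Lemma beta_lim : is_lim_seq beta 0.
Proof.
apply is_lim_seq_ext with (fun n => sqrt (beta n ^ 2)).
{ intros n; apply sqrt_pow2; left; apply beta_pos. }
replace 0 with (sqrt 0) by apply sqrt_0.
apply is_lim_seq_continuous; [apply continuity_pt_sqrt; lra|].
apply is_lim_seq_le_le with (fun _ => 0) (fun n => / (2 * INR n + 1)).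
- intros n; split; [apply pow2_ge_0|].
  pose proof (pos_INR n).
  apply Rmult_le_reg_r with (2 * INR n + 1); [lra|].
  rewrite Rinv_l by lra; apply beta_sq_le.
- apply is_lim_seq_const.
- apply is_lim_seq_inv_affine; lra.
Qed.

(* Coquelicot's rules, at type [R] so that [ring] and [lra] apply to the goals. *)
Lemma is_series_R_ext (a b : nat -> R) (l m : R) :
  is_series a l -> (forall n, a n = b n) -> l = m -> is_series b m.
Proof. intros H E <-; revert H; now apply is_series_ext. Qed.

Lemma is_series_R_plus (a b : nat -> R) (l m : R) :
  is_series a l -> is_series b m -> is_series (fun n => a n + b n) (l + m).
Proof. exact (is_series_plus (V := R_NormedModule) a b l m). Qed.

Lemma is_series_R_minus (a b : nat -> R) (l m : R) :
  is_series a l -> is_series b m -> is_series (fun n => a n - b n) (l - m).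
Proof. exact (is_series_minus (V := R_NormedModule) a b l m). Qed.

Lemma is_series_R_scal (c : R) (a : nat -> R) (l : R) :
  is_series a l -> is_series (fun n => c * a n) (c * l).
Proof. exact (is_series_scal_l (K := R_AbsRing) c a l). Qed.

Lemma is_series_telescope (e : nat -> R) (l : R) :
  is_lim_seq e l -> is_series (fun k => e (S k) - e k) (l - e 0%nat).
Proof.
intros H.
change (is_lim_seq (sum_n (fun k => e (S k) - e k)) (Finite (l - e 0%nat))).
apply (is_lim_seq_ext (fun n => e (S n) - e 0%nat)).
- intros n; induction n as [|n IH]; [now rewrite sum_O|].
  rewrite sum_Sn, <- IH; unfold plus; simpl; ring.
- apply is_lim_seq_minus'; [now apply is_lim_seq_incr_1 in H|apply is_lim_seq_const].
Qed.

(** The terms are the differences of [-2 * beta k]. This is the majorant for all the series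
    [gterm N n]. *)
Lemma is_series_beta_inv : is_series (fun k => beta k / INR (S k)) 2.
Proof.
pose proof (is_series_telescope (fun k => -2 * beta k) 0) as H.
cbv beta in H; rewrite beta_0 in H.
refine (is_series_R_ext _ _ _ _ (H _) _ _).
- replace 0 with (-2 * 0) by ring.
  apply (is_lim_seq_scal_l beta (-2) 0), beta_lim.
- intros k; rewrite beta_S_div, S_INR; pose proof (pos_INR k); field; lra.
- ring.
Qed.

Lemma ex_series_beta_le (u : nat -> R) (c : R) :
  (forall k, Rabs (u k) <= c * (beta k / INR (S k))) -> ex_series u.
Proof.
intros H; apply (ex_series_le (K := R_AbsRing) (V := R_CompleteNormedModule) u _ H).
exists (c * 2); apply is_series_R_scal, is_series_beta_inv.
Qed.

(* The contribution of [k] to the coefficient of [x ^ n] in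
   [(x + N) * sum_k beta k / (k + x + N)].  The shape of the case [n = 0] makes
   the term [k = N = 0] equal to 1. *)
Definition gterm (N n k : nat) : R :=
  match n with
  | O => beta k * (1 - INR k / (INR N + INR k))
  | S p => (-1) ^ p * beta k * INR k / (INR N + INR k) ^ (p + 2)
  end.

Definition gcoef (N n : nat) : R := Series (gterm N n).

Lemma gterm_0_pos N k : (0 < N)%nat -> gterm N 0 k = beta k * INR N / (INR N + INR k).
Proof.
intros HN; apply lt_0_INR in HN; pose proof (pos_INR k).
unfold gterm; field; lra.
Qed.

Lemma gterm_S_le N p k : Rabs (gterm N (S p) k) <= beta k * INR k / (INR N + INR k) ^ 2.
Proof.
unfold gterm.
destruct k as [|k]; [simpl INR; unfold Rdiv; rewrite Rmult_0_r, !Rmult_0_l, Rabs_R0; lra|].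
assert (H1 : 1 <= INR N + INR (S k)) by (rewrite S_INR; pose proof (pos_INR k); pose proof (pos_INR N); lra).
unfold Rdiv; rewrite !Rabs_mult, pow_1_abs, Rmult_1_l.
pose proof (beta_pos (S k)); assert (0 < INR (S k)) by (apply lt_0_INR; lia).
rewrite (Rabs_pos_eq (beta _)), (Rabs_pos_eq (INR _)) by lra.
assert (0 < (INR N + INR (S k)) ^ 2) by (apply pow_lt; lra).
assert (0 < (INR N + INR (S k)) ^ (p + 2)) by (apply pow_lt; lra).
rewrite Rabs_pos_eq by (left; now apply Rinv_0_lt_compat).
apply Rmult_le_compat_l; [nra|].
apply Rinv_le_contravar; [assumption|].
rewrite pow_add; assert (1 <= (INR N + INR (S k)) ^ p) by (now apply pow_R1_Rle); nra.
Qed.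

Lemma is_series_gterm N n : is_series (gterm N n) (gcoef N n).
Proof.
apply Series_correct; destruct n as [|p].
- apply (ex_series_beta_le _ (INR N + 1)); intros k.
  pose proof (beta_pos k); pose proof (pos_INR k); pose proof (pos_INR N).
  rewrite S_INR.
  destruct N as [|N].
  + unfold gterm; destruct k as [|k].
    * simpl; rewrite beta_0, Rabs_pos_eq; unfold Rdiv; rewrite ?Rmult_0_l; lra.
    * rewrite S_INR in *; simpl INR at 1; rewrite Rplus_0_l.
      replace (1 - (INR k + 1) / (INR k + 1)) with 0 by (field; pose proof (pos_INR k); lra).
      rewrite Rmult_0_r, Rabs_R0; apply Rmult_le_pos; [simpl; lra|].
      apply Rdiv_le_0_compat; lra.
  + rewrite gterm_0_pos by lia.
    assert (0 < INR (S N)) by (apply lt_0_INR; lia).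
    set (y := INR (S N)) in *.
    rewrite Rabs_pos_eq by (apply Rdiv_le_0_compat; nra).
    replace ((y + 1) * (beta k / (INR k + 1))) with (beta k * ((y + 1) / (INR k + 1))) by (field; lra).
    unfold Rdiv; rewrite Rmult_assoc; apply Rmult_le_compat_l; [lra|].
    apply Rle_div_l; [lra|].
    replace ((y + 1) * / (INR k + 1) * (y + INR k)) with ((y + 1) * (y + INR k) / (INR k + 1)) by (field; lra).
    apply Rle_div_r; [lra|]; nra.
- apply (ex_series_beta_le _ 2); intros k.
  refine (Rle_trans _ _ _ (gterm_S_le N p k) _).
  pose proof (beta_pos k); pose proof (pos_INR N).
  destruct k as [|k].
  + simpl INR at 1; unfold Rdiv at 1; rewrite Rmult_0_r, Rmult_0_l.
    rewrite beta_0; simpl; lra.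
  + assert (1 <= INR (S k)) by (rewrite S_INR; pose proof (pos_INR k); lra).
    rewrite (S_INR (S k)); set (y := INR (S k)) in *; set (z := INR N) in *.
    replace (2 * (beta (S k) / (y + 1))) with (beta (S k) * (2 / (y + 1))) by (field; lra).
    unfold Rdiv; rewrite Rmult_assoc; apply Rmult_le_compat_l; [lra|].
    apply Rle_div_l; [apply pow_lt; lra|].
    replace (2 * / (y + 1) * (z + y) ^ 2) with (2 * (z + y) ^ 2 / (y + 1)) by (field; lra).
    apply Rle_div_r; [lra|]; nra.
Qed.

(** With y = N, the difference of the k-th terms is d_(k+1) - d_k for d_k = (y + 1) k b_k / (y + k),
    because (k + 1) b_(k+1) = (k + 1/2) b_k. Here d_0 = 0, and d tends to 0 with b. *)
Lemma gcoef_0_rec N : INR (S N) * gcoef N 0 = (INR N + / 2) * gcoef (S N) 0.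
Proof.
pose (d := fun k => INR (S N) * (beta k * INR k / (INR N + INR k))).
assert (Hd : is_lim_seq d 0).
{ apply is_lim_seq_abs_0.
  apply is_lim_seq_le_le with (fun _ => 0) (fun k => INR (S N) * beta k).
  - intros k; split; [apply Rabs_pos|]; unfold d.
    pose proof (beta_pos k); pose proof (pos_INR k); pose proof (pos_INR N); pose proof (pos_INR (S N)).
    rewrite Rabs_mult, (Rabs_pos_eq (INR (S N))) by assumption.
    apply Rmult_le_compat_l; [assumption|].
    destruct k as [|k].
    + simpl INR at 1; unfold Rdiv; rewrite Rmult_0_r, Rmult_0_l, Rabs_R0; lra.
    + assert (0 < INR (S k)) by (apply lt_0_INR; lia).
      rewrite Rabs_pos_eq by (apply Rdiv_le_0_compat; nra).
      apply Rle_div_l; [lra|]; apply Rmult_le_compat_l; lra.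
  - apply is_lim_seq_const.
  - replace 0 with (INR (S N) * 0) by ring; apply (is_lim_seq_scal_l beta (INR (S N)) 0), beta_lim. }
pose proof (is_series_telescope d 0 Hd) as T.
replace (0 - d 0%nat) with 0 in T.
2:{ unfold d; change (INR 0) with 0; unfold Rdiv; ring. }
assert (E : is_series (fun k => INR (S N) * gterm N 0 k - (INR N + / 2) * gterm (S N) 0 k)
              (INR (S N) * gcoef N 0 - (INR N + / 2) * gcoef (S N) 0)).
{ apply is_series_R_minus; apply is_series_R_scal, is_series_gterm. }
apply Rminus_diag_uniq; rewrite <- (is_series_unique _ _ E).
apply is_series_unique; refine (is_series_R_ext _ _ _ _ T _ eq_refl); intros k.
rewrite (gterm_0_pos (S N)) by lia; unfold gterm, d.
rewrite !beta_S_div, (S_INR N), (S_INR k).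
pose proof (pos_INR N) as HN; pose proof (pos_INR k) as Hk.
destruct N as [|N].
- destruct k as [|k].
  + simpl; unfold Rdiv; rewrite beta_0, ?Rmult_0_r, ?Rmult_0_l, ?Rmult_0_r, ?Rplus_0_l; field.
  + rewrite (S_INR k) in *; simpl INR; field; pose proof (pos_INR k); lra.
- rewrite (S_INR N) in *; field; pose proof (pos_INR N); lra.
Qed.

Lemma gcoef_S_rec N n :
  INR (S N) * gcoef N (S n) + gcoef N n
  = (INR N + / 2) * gcoef (S N) (S n) + gcoef (S N) n.
Proof.
(* The coefficient of x^(n+1) in the previous certificate (y + 1) k b_k / (y + k) at y = x + N. The
   factor k - 1 is (N + k) - (N + 1). *)
pose (c := fun k => (-1) ^ n * (beta k * INR k * (INR k - 1) / (INR N + INR k) ^ (n + 2))).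
assert (Hc : is_lim_seq c 0).
{ apply is_lim_seq_abs_0.
  apply is_lim_seq_le_le with (fun _ => 0) beta; [|apply is_lim_seq_const|apply beta_lim].
  intros k; split; [apply Rabs_pos|]; unfold c.
  pose proof (beta_pos k); pose proof (pos_INR N).
  rewrite Rabs_mult, pow_1_abs, Rmult_1_l.
  destruct k as [|k].
  - simpl INR at 1; unfold Rdiv; rewrite Rmult_0_r, !Rmult_0_l, Rabs_R0; lra.
  - assert (1 <= INR (S k)) by (rewrite S_INR; pose proof (pos_INR k); lra).
    set (y := INR (S k)) in *; set (z := INR N) in *.
    assert (0 < (z + y) ^ (n + 2)) by (apply pow_lt; lra).
    rewrite Rabs_pos_eq.
    2:{ apply Rdiv_le_0_compat; [|assumption]; apply Rmult_le_pos; [nra|lra]. }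
    apply Rle_div_l; [assumption|].
    rewrite Rmult_assoc; apply Rmult_le_compat_l; [lra|].
    rewrite pow_add; assert (1 <= (z + y) ^ n) by (apply pow_R1_Rle; lra).
    assert (y * (y - 1) <= (z + y) ^ 2) by nra.
    assert (0 <= (z + y) ^ 2) by apply pow2_ge_0; nra. }
pose proof (is_series_telescope c 0 Hc) as T.
replace (0 - c 0%nat) with 0 in T.
2:{ unfold c; change (INR 0) with 0; unfold Rdiv; ring. }
assert (E : is_series (fun k => (INR (S N) * gterm N (S n) k + gterm N n k)
                  - ((INR N + / 2) * gterm (S N) (S n) k + gterm (S N) n k))
              ((INR (S N) * gcoef N (S n) + gcoef N n)
                  - ((INR N + / 2) * gcoef (S N) (S n) + gcoef (S N) n))).
{ apply is_series_R_minus; apply is_series_R_plus; try apply is_series_R_scal; apply is_series_gterm. }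
apply Rminus_diag_uniq; rewrite <- (is_series_unique _ _ E).
apply is_series_unique; refine (is_series_R_ext _ _ _ _ T _ eq_refl); intros k.
assert (Z : INR N + INR k = 0 \/ 0 < INR N + INR k).
{ pose proof (pos_INR N); pose proof (pos_INR k); lra. }
pose proof (pos_INR N); pose proof (pos_INR k).
unfold gterm, c; rewrite !beta_S_div, (S_INR N), (S_INR k).
destruct Z as [Z|Z].
(* For N = k = 0 every inverse of 0 is multiplied by k = 0, so these inverses can be generalized
   away. *)
- assert (HN : INR N = 0) by lra; assert (Hk : INR k = 0) by lra.
  rewrite HN, Hk; unfold Rdiv; destruct n as [|n].
  + generalize (/ (0 + 0) ^ (0 + 2)) (/ (0 + 0)); intros; simpl; field.
  + generalize (/ (0 + 0) ^ (S n + 2)) (/ (0 + 0) ^ (n + 2)); intros.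
    replace (0 + 1 - 1) with 0 by ring; replace (0 + 1 + 0) with 1 by ring.
    rewrite !pow1; simpl; field; apply pow_nonzero; lra.
- replace (INR N + (INR k + 1)) with (INR N + 1 + INR k) by ring.
  destruct n as [|n]; [simpl; field; lra|].
  rewrite !pow_add; simpl (_ ^ S n).
  field; repeat split; try apply pow_nonzero; lra.
Qed.

(** * The product expansion *)

(** Both sides satisfy [gcoef_0_rec]; at N = 0 only the term k = 0 survives, and it equals 1. *)
Lemma gcoef_n_0 N : gcoef N 0 = / beta N.
Proof.
induction N as [|N IH].
- rewrite beta_0, Rinv_1; apply is_series_unique.
  refine (is_series_R_ext _ _ _ _ (is_series_telescope (fun k => if (k =? 0)%nat then 0 else 1) 1 _) _ _).
  + apply is_lim_seq_incr_1; apply is_lim_seq_const.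
  + intros [|k]; unfold gterm; simpl Nat.eqb; cbv iota.
    * rewrite beta_0; simpl; unfold Rdiv; ring.
    * simpl (INR 0); rewrite Rplus_0_l; field; apply not_0_INR; lia.
  + simpl; ring.
- pose proof (gcoef_0_rec N) as H; rewrite IH in H.
  pose proof (beta_pos N); pose proof (pos_INR N).
  rewrite beta_S_div, S_INR in *.
  replace (gcoef (S N) 0) with ((INR N + / 2) * gcoef (S N) 0 / (INR N + / 2)) by (field; lra).
  rewrite <- H; field; lra.
Qed.

Lemma Rabs_Series_le (a b : nat -> R) (l : R) :
  (forall n, Rabs (a n) <= b n) -> is_series b l -> Rabs (Series a) <= l.
Proof.
intros H Hb; rewrite <- (is_series_unique _ _ Hb).
assert (E : ex_series (fun n => Rabs (a n))).
{ apply (ex_series_le (K := R_AbsRing) (V := R_CompleteNormedModule) _ b).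
  - intros n; unfold norm; simpl; unfold abs; simpl; rewrite Rabs_Rabsolu; apply H.
  - now exists l. }
refine (Rle_trans _ _ _ (Series_Rabs _ E) _).
apply Series_le; [|now exists l].
intros n; split; [apply Rabs_pos|apply H].
Qed.

(** In positive degree each term is at most b_k / (N + 1 + k), which is 1 / (N + 1) times the term
    of degree 0. This gain is what sends all but the constant coefficient to 0 in [gcoef_lim]. *)
Lemma gcoef_S_le N p : Rabs (gcoef (S N) (S p)) <= / INR (S N) * / beta (S N).
Proof.
rewrite <- gcoef_n_0; apply Rabs_Series_le with (fun k => / INR (S N) * gterm (S N) 0 k).
- intros k; refine (Rle_trans _ _ _ (gterm_S_le _ _ _) _).
  rewrite gterm_0_pos by lia.
  pose proof (beta_pos k); pose proof (pos_INR k).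
  assert (0 < INR (S N)) by (apply lt_0_INR; lia).
  set (y := INR (S N)) in *.
  replace (/ y * (beta k * y / (y + INR k))) with (beta k * (y + INR k) / (y + INR k) ^ 2) by (field; lra).
  apply Rmult_le_compat_r; [|apply Rmult_le_compat_l; lra].
  left; apply Rinv_0_lt_compat, pow_lt; lra.
- apply is_series_R_scal, is_series_gterm.
Qed.

Lemma gcoef_lim n : is_lim_seq (fun N => beta N * gcoef N n) (fps1 n).
Proof.
destruct n as [|p].
- apply is_lim_seq_ext with (fun _ => 1); [|apply is_lim_seq_const].
  intros N; rewrite gcoef_n_0; pose proof (beta_pos N); field; lra.
- apply is_lim_seq_incr_1, is_lim_seq_abs_0.
  apply is_lim_seq_le_le with (fun _ => 0) (fun N => / (1 * INR N + 1));
    [|apply is_lim_seq_const|apply is_lim_seq_inv_affine; lra].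
  intros N; split; [apply Rabs_pos|].
  pose proof (beta_pos (S N)); pose proof (gcoef_S_le N p).
  rewrite Rabs_mult, Rabs_pos_eq by lra.
  rewrite Rmult_1_l, <- S_INR.
  replace (/ INR (S N)) with (beta (S N) * (/ INR (S N) * / beta (S N)))
    by (field; split; [apply not_0_INR; lia|lra]).
  apply Rmult_le_compat_l; [lra|assumption].
Qed.

(** * Linear factors and the finite products *)

Definition fps_lin (c : R) : nat -> R :=
  fun n => match n with O => 1 | S O => c | _ => 0 end.
Definition fps_geo (c : R) : nat -> R := fun n => (- c) ^ n.
(** The expansion of c x / (1 + c x), the logarithmic derivative of 1 + c x under [theta];
    [fps_geo c] is 1 / (1 + c x). *)
Definition fps_lin_log (c : R) : nat -> R :=
  fun n => if (n =? 0)%nat then 0 else - (- c) ^ n.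

Lemma fps_mul_lin_S c a n : fps_mul (fps_lin c) a (S n) = a (S n) + c * a n.
Proof.
rewrite fps_mul_Sl; simpl fps_lin; rewrite Rmult_1_l; f_equal.
replace (fps_tail (fps_lin c)) with (fun n => c * fps1 n).
- rewrite fps_mul_scal_l, fps_mul_1_l; reflexivity.
- extensionality k; destruct k; unfold fps_tail, fps1; simpl; ring.
Qed.

Lemma fps_lin_geo c : fps_mul (fps_lin c) (fps_geo c) = fps1.
Proof.
extensionality n; destruct n as [|n].
- rewrite fps_mul_0; unfold fps_geo, fps1; simpl; ring.
- rewrite fps_mul_lin_S; unfold fps_geo, fps1; simpl; ring.
Qed.

Lemma theta_fps_lin c : theta (fps_lin c) = fps_mul (fps_lin_log c) (fps_lin c).
Proof.
rewrite fps_mul_comm; extensionality n; destruct n as [|n].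
- rewrite fps_mul_0; unfold theta, fps_lin_log; simpl; ring.
- rewrite fps_mul_lin_S; unfold theta, fps_lin_log; destruct n; simpl; ring.
Qed.

Lemma theta_fps_geo c :
  theta (fps_geo c) = fps_mul (fps_opp (fps_lin_log c)) (fps_geo c).
Proof.
assert (H : theta (fps_mul (fps_lin c) (fps_geo c)) = fps0).
{ rewrite fps_lin_geo; extensionality n; unfold theta, fps1, fps0; destruct n; simpl; ring. }
rewrite theta_mul, theta_fps_lin in H.
transitivity (fps_mul (fps_mul (fps_lin c) (fps_geo c)) (theta (fps_geo c))).
{ rewrite fps_lin_geo; ring. }
transitivity (fps_mul (fps_geo c) (fps_sub
   (fps_add (fps_mul (fps_mul (fps_lin_log c) (fps_lin c)) (fps_geo c)) (fps_mul (fps_lin c) (theta (fps_geo c))))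
   (fps_mul (fps_lin_log c) (fps_mul (fps_lin c) (fps_geo c))))); [ring|].
rewrite H, fps_lin_geo; ring.
Qed.

(* [prod_(1 <= r <= N) (1 + x / r) / (1 + x / (r - 1/2))] and its logarithmic derivative. *)
Fixpoint wallis (N : nat) : nat -> R :=
  match N with
  | O => fps1
  | S M => fps_mul (fps_mul (fps_lin (/ INR N)) (fps_geo (/ (INR M + / 2)))) (wallis M)
  end.

Fixpoint wallis_log (N : nat) : nat -> R :=
  match N with
  | O => fps0
  | S M => fps_add (fps_add (fps_lin_log (/ INR N)) (fps_opp (fps_lin_log (/ (INR M + / 2)))))
             (wallis_log M)
  end.

Lemma theta_wallis N : theta (wallis N) = fps_mul (wallis_log N) (wallis N).
Proof.
induction N as [|N IH]; simpl.
- extensionality n; unfold theta, fps_mul, PS_mult, fps0, fps1.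
  rewrite (sum_eq _ (fun _ => 0)) by (intros; ring); rewrite sum_cte.
  destruct n; simpl; ring.
- apply theta_mul_log; [|assumption].
  apply theta_mul_log; [apply theta_fps_lin|apply theta_fps_geo].
Qed.

Lemma wallis_0 N : wallis N 0%nat = 1.
Proof.
induction N as [|N IH]; simpl; [reflexivity|].
rewrite !fps_mul_0, IH; unfold fps_geo; simpl; ring.
Qed.

Lemma wallis_log_0 N : wallis_log N 0%nat = 0.
Proof.
induction N as [|N IH]; simpl; [reflexivity|].
unfold fps_add, fps_opp; rewrite IH; unfold fps_lin_log; simpl; ring.
Qed.

(** As an identity of series, [gcoef_S_rec] reads (x + N + 1) F_N = (x + N + 1/2) F_(N+1).
    Normalising both linear factors to constant term 1 produces the ratio b_(N+1) / b_N and one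
    factor of the product. *)
Lemma gcoef_wallis N : fps_mul (wallis N) (gcoef 0) = (fun n => beta N * gcoef N n).
Proof.
induction N as [|N IH].
- simpl wallis; rewrite fps_mul_1_l; extensionality n; rewrite beta_0; ring.
- change (wallis (S N)) with
    (fps_mul (fps_mul (fps_lin (/ INR (S N))) (fps_geo (/ (INR N + / 2)))) (wallis N)).
  rewrite <- fps_mul_assoc, IH.
  set (h := fun n => beta N * gcoef N n).
  set (h' := fun n => beta (S N) * gcoef (S N) n).
  assert (E : fps_mul (fps_lin (/ INR (S N))) h = fps_mul (fps_lin (/ (INR N + / 2))) h').
  { assert (0 < INR (S N)) by (apply lt_0_INR; lia).
    pose proof (pos_INR N); pose proof (beta_pos N); pose proof (beta_pos (S N)).
    extensionality n; destruct n as [|n].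
    - rewrite !fps_mul_0; unfold h, h'; rewrite !gcoef_n_0; simpl fps_lin; field; lra.
    - rewrite !fps_mul_lin_S; unfold h, h'.
      pose proof (gcoef_S_rec N n) as R.
      replace (beta N * gcoef N (S n) + / INR (S N) * (beta N * gcoef N n))
        with (beta N / INR (S N) * (INR (S N) * gcoef N (S n) + gcoef N n)) by (field; lra).
      rewrite R, beta_S_div; field; lra. }
  transitivity (fps_mul (fps_geo (/ (INR N + / 2))) (fps_mul (fps_lin (/ INR (S N))) h)); [ring|].
  rewrite E.
  transitivity (fps_mul (fps_mul (fps_lin (/ (INR N + / 2))) (fps_geo (/ (INR N + / 2)))) h'); [ring|].
  rewrite fps_lin_geo; ring.
Qed.

(** * Partial zeta sums and the limit ln 2 *)

Definition zsum (j N : nat) : R := sum_n_m (fun m => / INR m ^ j) 1 N.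

Lemma zsum_0 j : zsum j 0 = 0.
Proof. unfold zsum; rewrite sum_n_m_zero by lia; reflexivity. Qed.

Lemma zsum_S j N : zsum j (S N) = zsum j N + / INR (S N) ^ j.
Proof. unfold zsum; rewrite sum_n_Sm by lia; reflexivity. Qed.

Lemma harmonic_zsum n : harmonic n = zsum 1 n.
Proof. unfold harmonic, zsum; apply sum_n_m_ext; intros k; rewrite pow_1; reflexivity. Qed.

Lemma harmonic_S n : harmonic (S n) = harmonic n + / INR (S n).
Proof. rewrite !harmonic_zsum, zsum_S, pow_1; reflexivity. Qed.

Lemma zsum_sum_n j N : sum_n (fun m => / INR (S m) ^ j) N = zsum j (S N).
Proof.
induction N as [|N IH]; [rewrite sum_O, zsum_S, zsum_0, Rplus_0_l; reflexivity|].
rewrite sum_Sn, IH, (zsum_S j (S N)); reflexivity.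
Qed.

Lemma ex_series_inv_sq : ex_series (fun n => / INR (S n) ^ 2).
Proof.
pose proof (is_series_telescope (fun n => -2 * / INR (S n)) 0) as H.
apply (ex_series_le (K := R_AbsRing) (V := R_CompleteNormedModule) _
   (fun n => -2 * / INR (S (S n)) - -2 * / INR (S n))).
- intros n; rewrite !S_INR; unfold norm; simpl; unfold abs; simpl; pose proof (pos_INR n).
  rewrite Rabs_pos_eq by (left; apply Rinv_0_lt_compat; nra).
  replace (-2 * / (INR n + 1 + 1) - -2 * / (INR n + 1)) with (/ ((INR n + 1) * ((INR n + 2) / 2))) by (field; lra).
  apply Rinv_le_contravar; nra.
- eexists; apply H.
  replace 0 with (-2 * 0) by ring; apply (is_lim_seq_scal_l (fun n => / INR (S n)) (-2) 0).
  apply is_lim_seq_ext with (fun n => / (1 * INR n + 1)).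
  + intros n; rewrite S_INR, Rmult_1_l; reflexivity.
  + apply is_lim_seq_inv_affine; lra.
Qed.

Lemma is_series_zeta j : (2 <= j)%nat -> is_series (fun n => / INR (S n) ^ j) (zeta j).
Proof.
intros Hj; apply Series_correct.
refine (ex_series_le (K := R_AbsRing) (V := R_CompleteNormedModule) _ _ _ ex_series_inv_sq).
intros n; unfold norm; simpl; unfold abs; simpl.
assert (1 <= INR (S n)) by (rewrite S_INR; pose proof (pos_INR n); lra).
change (match n with 0%nat => 1 | S _ => INR n + 1 end) with (INR (S n)).
rewrite Rabs_pos_eq by (left; apply Rinv_0_lt_compat, pow_lt; lra).
apply Rinv_le_contravar; [nra|].
replace (INR (S n) * (INR (S n) * 1)) with (INR (S n) ^ 2) by ring.
apply Rle_pow; [lra|lia].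
Qed.

Lemma zsum_lim j : (2 <= j)%nat -> is_lim_seq (zsum j) (zeta j).
Proof.
intros Hj; apply is_lim_seq_incr_1.
apply is_lim_seq_ext with (sum_n (fun m => / INR (S m) ^ j)); [apply zsum_sum_n|].
exact (is_series_zeta j Hj).
Qed.

Lemma ln_le_minus_1 y : 0 < y -> ln y <= y - 1.
Proof.
intros Hy; pose proof (exp_ineq1_le (ln y)) as H; rewrite exp_ln in H by assumption; lra.
Qed.

(** Each step uses ln z <= z - 1 at z = y / (y + 1); the lower bound below uses z = (y + 1) / y. *)
Lemma harmonic_diff_le N m : (0 < N)%nat ->
  harmonic (N + m) - harmonic N <= ln (INR (N + m)) - ln (INR N).
Proof.
intros HN; induction m as [|m IH]; [rewrite Nat.add_0_r; lra|].
rewrite Nat.add_succ_r, harmonic_S.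
assert (0 < INR (N + m)) by (apply lt_0_INR; lia).
rewrite S_INR in *; set (y := INR (N + m)) in *.
assert (K : ln (y / (y + 1)) <= y / (y + 1) - 1).
{ apply ln_le_minus_1, Rdiv_lt_0_compat; lra. }
rewrite ln_div in K by lra.
replace (y / (y + 1) - 1) with (- / (y + 1)) in K by (field; lra).
lra.
Qed.

Lemma harmonic_diff_ge N m :
  ln (INR (S (N + m))) - ln (INR (S N)) <= harmonic (N + m) - harmonic N.
Proof.
induction m as [|m IH]; [rewrite Nat.add_0_r; lra|].
rewrite Nat.add_succ_r, harmonic_S.
rewrite (S_INR (S (N + m))).
assert (0 < INR (S (N + m))) by (apply lt_0_INR; lia).
set (y := INR (S (N + m))) in *.
assert (K : ln ((y + 1) / y) <= (y + 1) / y - 1).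
{ apply ln_le_minus_1, Rdiv_lt_0_compat; lra. }
rewrite ln_div in K by lra.
replace ((y + 1) / y - 1) with (/ y) in K by (field; lra).
lra.
Qed.

Lemma harmonic_diff_lim : is_lim_seq (fun N => harmonic (2 * N) - harmonic N) (ln 2).
Proof.
apply is_lim_seq_le_le with (fun N => ln (2 - / (1 * INR N + 1))) (fun _ => ln 2).
- intros N; replace (2 * N)%nat with (N + N)%nat by lia; split.
  + pose proof (harmonic_diff_ge N N) as H.
    rewrite <- ln_div in H by (apply lt_0_INR; lia).
    rewrite !S_INR, plus_INR in H; pose proof (pos_INR N).
    replace (2 - / (1 * INR N + 1)) with ((INR N + INR N + 1) / (INR N + 1)) by (field; lra).
    exact H.
  + destruct N as [|N]; [simpl; rewrite Rminus_diag; rewrite <- ln_1; left; apply ln_increasing; lra|].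
    assert (0 < INR (S N)) by (apply lt_0_INR; lia).
    pose proof (harmonic_diff_le (S N) (S N) ltac:(lia)) as H'.
    rewrite plus_INR in H'.
    replace (INR (S N) + INR (S N)) with (2 * INR (S N)) in H' by ring.
    rewrite ln_mult in H' by lra; lra.
- apply (is_lim_seq_continuous ln); [apply derivable_continuous_pt; exists (/ 2); apply derivable_pt_lim_ln; lra|].
  replace (Finite 2) with (Finite (2 - 0)) by (f_equal; ring).
  apply is_lim_seq_minus'; [apply is_lim_seq_const|apply is_lim_seq_inv_affine; lra].
- apply is_lim_seq_const.
Qed.

(** Since (r - 1/2)^(-i) = 2^i (2r - 1)^(-i), the half-integers give a sum over odd numbers, that
    is, all numbers up to 2N minus the even ones. In degree 1 this is -2 (H_(2N) - H_N), the origin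
    of ln 2. *)
Lemma wallis_log_S N j :
  wallis_log N (S j) = (-1) ^ S j * (2 ^ S j * zsum (S j) (2 * N) - 2 * zsum (S j) N).
Proof.
induction N as [|N IH]; [simpl (2 * 0)%nat; rewrite zsum_0; change (wallis_log 0 (S j)) with 0; ring|].
change (wallis_log (S N)) with
  (fps_add (fps_add (fps_lin_log (/ INR (S N))) (fps_opp (fps_lin_log (/ (INR N + / 2)))))
     (wallis_log N)).
unfold fps_add, fps_opp; rewrite IH.
replace (2 * S N)%nat with (S (S (2 * N))) by lia.
rewrite !zsum_S; unfold fps_lin_log; simpl Nat.eqb; cbv iota.
pose proof (pos_INR N).
replace (INR (S (S (2 * N)))) with (2 * (INR N + 1)) by (rewrite !S_INR, mult_INR; simpl; ring).
replace (INR (S (2 * N))) with (2 * (INR N + / 2)) by (rewrite !S_INR, mult_INR; simpl; field).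
rewrite (S_INR N), !Rpow_mult_distr.
replace (- / (INR N + 1)) with ((-1) * / (INR N + 1)) by ring.
replace (- / (INR N + / 2)) with ((-1) * / (INR N + / 2)) by ring.
assert (H2 : 2 ^ S j <> 0) by (apply pow_nonzero; lra).
rewrite !Rpow_mult_distr, !Rinv_mult, !pow_inv; revert H2.
generalize ((-1) ^ S j) (2 ^ S j) (/ (INR N + 1) ^ S j) (/ (INR N + / 2) ^ S j).
intros; field; assumption.
Qed.

(** With g the Euler constant, log Gamma(1 + t) = -g t + sum_(j >= 2) (-1)^j zeta(j) t^j / j. Hence
    [bell_egf xC] is Gamma(1 + t) e^(g t) and [bell_egf xD] is its reciprocal; in [Bser] the factors
    e^(2 g s) and e^(-2 g s) cancel. *)
Definition xC (j : nat) : R :=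
  if (j <=? 1)%nat then 0 else (-1) ^ j * INR (fact (j - 1)) * zeta j.
Definition xD (j : nat) : R :=
  if (j <=? 1)%nat then 0 else (-1) ^ (j - 1) * INR (fact (j - 1)) * zeta j.
Definition fps_pow_2 : nat -> R := fun n => (-2 * ln 2) ^ n / INR (fact n).
Definition fps_x (c : R) : nat -> R := fun n => if (n =? 1)%nat then c else 0.

Lemma theta_fps_pow_2 : theta fps_pow_2 = fps_mul (fps_x (-2 * ln 2)) fps_pow_2.
Proof.
extensionality n; destruct n as [|n].
- rewrite fps_mul_0; unfold theta, fps_x; simpl; ring.
- rewrite fps_mul_Sl.
  replace (fps_tail (fps_x (-2 * ln 2))) with (fun n => (-2 * ln 2) * fps1 n).
  + rewrite fps_mul_scal_l, fps_mul_1_l; unfold theta, fps_x, fps_pow_2.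
    rewrite fact_simpl, mult_INR; simpl (_ ^ S n); simpl Nat.eqb; cbv iota.
    field; split; [apply INR_fact_neq_0|apply not_0_INR; lia].
  + extensionality k; destruct k; unfold fps_tail, fps_x, fps1; simpl; ring.
Qed.

(* [Gamma (1 + 2 s) / (Gamma (1 + s) ^ 2 * 4 ^ s)], which interpolates [beta]. *)
Definition Bser : nat -> R :=
  fps_mul (fps_scale 2 (bell_egf xC))
    (fps_mul (bell_egf xD) (fps_mul (bell_egf xD) fps_pow_2)).

Definition Bser_log : nat -> R :=
  fps_add (fps_scale 2 (theta (bell_arg xC)))
    (fps_add (theta (bell_arg xD)) (fps_add (theta (bell_arg xD)) (fps_x (-2 * ln 2)))).

Lemma theta_Bser : theta Bser = fps_mul Bser_log Bser.
Proof.
unfold Bser, Bser_log.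
apply theta_mul_log; [apply theta_scale_log, theta_bell_egf|].
apply theta_mul_log; [apply theta_bell_egf|].
apply theta_mul_log; [apply theta_bell_egf|].
apply theta_fps_pow_2.
Qed.

Lemma Bser_log_SS j :
  Bser_log (S (S j)) = (-1) ^ S (S j) * (2 ^ S (S j) * zeta (S (S j)) - 2 * zeta (S (S j))).
Proof.
unfold Bser_log, fps_add, fps_scale, theta, bell_arg, xC, xD, fps_x.
simpl Nat.eqb; simpl Nat.leb; cbv iota.
replace (S (S j) - 1)%nat with (S j) by lia.
rewrite (fact_simpl (S j)), mult_INR.
rewrite <- !(tech_pow_Rmult (-1)).
field; split; [apply INR_fact_neq_0|apply not_0_INR; lia].
Qed.

Lemma Bser_0 : Bser 0%nat = 1.
Proof.
unfold Bser; rewrite !fps_mul_0, bell_egf_0; unfold fps_scale; rewrite bell_egf_0.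
unfold fps_pow_2; simpl; field.
Qed.

(** The infinite product for B, read off from logarithmic derivatives. Degree 1 is separate: there
    the two zeta sums diverge and only their difference converges. *)
Lemma wallis_lim n : is_lim_seq (fun N => wallis N n) (Bser n).
Proof.
apply theta_eq_lim with wallis_log Bser_log.
- apply theta_wallis.
- apply theta_Bser.
- apply wallis_0.
- apply Bser_0.
- apply wallis_log_0.
- unfold Bser_log, fps_add, fps_scale, theta, fps_x; simpl; ring.
- intros [|[|j]].
  + apply is_lim_seq_ext with (fun _ => 0).
    * intros N; now rewrite wallis_log_0.
    * replace (Bser_log 0) with 0; [apply is_lim_seq_const|].
      unfold Bser_log, fps_add, fps_scale, theta, fps_x; simpl; ring.
  + apply is_lim_seq_ext with (fun N => -2 * (harmonic (2 * N) - harmonic N)).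
    * intros N; rewrite wallis_log_S, !harmonic_zsum; ring.
    * replace (Bser_log 1) with (-2 * ln 2).
      -- apply (is_lim_seq_scal_l _ (-2) (ln 2)), harmonic_diff_lim.
      -- unfold Bser_log, fps_add, fps_scale, theta, bell_arg, xC, xD, fps_x; simpl; field.
  + rewrite Bser_log_SS.
    apply is_lim_seq_ext with (fun N => (-1) ^ S (S j) *
       (2 ^ S (S j) * zsum (S (S j)) (2 * N) - 2 * zsum (S (S j)) N)).
    * intros N; now rewrite wallis_log_S.
    * apply (is_lim_seq_scal_l _ _ (Finite _)), is_lim_seq_minus'.
      -- apply (is_lim_seq_scal_l _ _ (Finite _)).
         apply is_lim_seq_subseq with (u := zsum (S (S j))) (phi := fun N => (2 * N)%nat);
           [|apply zsum_lim; lia].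
         apply eventually_subseq; intros n'; lia.
      -- apply (is_lim_seq_scal_l _ _ (Finite _)), zsum_lim; lia.
Qed.

(** The limit of [gcoef_wallis], computed on the left by [wallis_lim] and on the right by
    [gcoef_lim]. *)
Lemma Bser_gcoef : fps_mul Bser (gcoef 0) = fps1.
Proof.
extensionality n.
assert (L : is_lim_seq (fun N => fps_mul (wallis N) (gcoef 0) n) (fps_mul Bser (gcoef 0) n)).
{ unfold fps_mul, PS_mult.
  assert (G : forall m, is_lim_seq (fun N => sum_f_R0 (fun k => wallis N k * gcoef 0 (n - k)) m)
     (sum_f_R0 (fun k => Bser k * gcoef 0 (n - k)) m)).
  { induction m as [|m IH]; simpl sum_f_R0; [|apply is_lim_seq_plus'; [apply IH|]];
    apply is_lim_seq_mult'; try apply wallis_lim; apply is_lim_seq_const. }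
  apply G. }
apply is_lim_seq_unique in L.
rewrite (Lim_seq_ext _ (fun N => beta N * gcoef N n)) in L.
2:{ intros N; now rewrite gcoef_wallis. }
rewrite (is_lim_seq_unique _ _ (gcoef_lim n)) in L.
injection L; auto.
Qed.

(** * The cotangent series as a product *)

Lemma is_series_sum_f_R0 (a : nat -> nat -> R) (l : nat -> R) m :
  (forall i, (i <= m)%nat -> is_series (a i) (l i)) ->
  is_series (fun k => sum_f_R0 (fun i => a i k) m) (sum_f_R0 l m).
Proof.
induction m as [|m IH]; intros H; simpl; [apply H; lia|].
apply is_series_R_plus; [apply IH; intros i Hi; apply H; lia|apply H; lia].
Qed.

(** * Exchanging summations in double series *)

Lemma sum_n_le_is_series (a : nat -> R) (l : R) n :
  (forall k, 0 <= a k) -> is_series a l -> sum_n a n <= l.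
Proof.
intros Ha H; apply (is_lim_seq_incr_compare (sum_n a)); [exact H|].
intros k; rewrite sum_Sn; unfold plus; simpl; pose proof (Ha (S k)); lra.
Qed.

Lemma is_series_le (a b : nat -> R) (l m : R) :
  (forall k, a k <= b k) -> is_series a l -> is_series b m -> l <= m.
Proof.
intros H Ha Hb.
apply (is_lim_seq_le (sum_n a) (sum_n b) l m); [|exact Ha|exact Hb].
intros n; apply sum_n_m_le; assumption.
Qed.

Lemma double_sum_n_le (u : nat -> nat -> R) (r c : nat -> R) (l : R) :
  (forall i j, 0 <= u i j) ->
  (forall i, is_series (u i) (r i)) -> (forall j, is_series (fun i => u i j) (c j)) ->
  is_series r l -> forall n, sum_n c n <= l.
Proof.
intros Hu Hr Hc Hl n.
apply (is_series_le (fun i => sum_n (u i) n) r); [| |assumption].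
- intros i; now apply sum_n_le_is_series.
- induction n as [|n IH].
  + rewrite sum_O; refine (is_series_R_ext _ _ _ _ (Hc 0%nat) _ eq_refl).
    intros i; now rewrite sum_O.
  + rewrite sum_Sn; refine (is_series_R_ext _ _ _ _ (is_series_R_plus _ _ _ _ IH (Hc (S n))) _ eq_refl).
    intros i; now rewrite sum_Sn.
Qed.

(** Bounded partial sums make the column sums converge to some m <= l; the same bound with rows and
    columns interchanged gives l <= m. *)
Lemma is_series_tonelli (u : nat -> nat -> R) (r c : nat -> R) (l : R) :
  (forall i j, 0 <= u i j) ->
  (forall i, is_series (u i) (r i)) -> (forall j, is_series (fun i => u i j) (c j)) ->
  is_series r l -> is_series c l.
Proof.
intros Hu Hr Hc Hl.
pose proof (double_sum_n_le u r c l Hu Hr Hc Hl) as Hb.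
assert (Hc0 : forall j, 0 <= c j).
{ intros j; refine (Rle_trans _ _ _ _ (sum_n_le_is_series _ _ 0 (fun i => Hu i j) (Hc j))).
  rewrite sum_O; apply Hu. }
destruct (ex_finite_lim_seq_incr (sum_n c) l) as [m Hm].
- intros n; rewrite sum_Sn; unfold plus; simpl; pose proof (Hc0 (S n)); lra.
- exact Hb.
- assert (H1 : m <= l).
  { apply (is_lim_seq_le (sum_n c) (fun _ => l) m l); [exact Hb|exact Hm|apply is_lim_seq_const]. }
  assert (H2 : l <= m).
  { apply (is_lim_seq_le (sum_n r) (fun _ => m) l m); [|exact Hl|apply is_lim_seq_const].
    apply (double_sum_n_le (fun j i => u i j) c r m); auto; intros; apply Hu. }
  replace l with m by lra; exact Hm.
Qed.

Lemma ex_series_column (u : nat -> nat -> R) (r : nat -> R) (l : R) :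
  (forall i j, 0 <= u i j) -> (forall i, is_series (u i) (r i)) -> is_series r l ->
  forall j, ex_series (fun i => u i j).
Proof.
intros Hu Hr Hl j.
apply (ex_series_le (K := R_AbsRing) (V := R_CompleteNormedModule) _ r); [|now exists l].
intros i; change (Rabs (u i j) <= r i); rewrite Rabs_pos_eq by apply Hu.
refine (Rle_trans _ _ _ _ (sum_n_le_is_series _ _ j (Hu i) (Hr i))).
destruct j as [|j]; [rewrite sum_O; lra|].
rewrite sum_Sn; unfold plus; simpl.
assert (0 <= sum_n (u i) j); [|lra].
clear - Hu; induction j as [|j IH]; [rewrite sum_O; apply Hu|].
rewrite sum_Sn; unfold plus; simpl; pose proof (Hu i (S j)); lra.
Qed.

(** Tonelli applies to |u| and to u + |u|; the difference is u. *)
Lemma is_series_fubini (u : nat -> nat -> R) (r r' c c' : nat -> R) (l l' : R) :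
  (forall i, is_series (u i) (r i)) -> (forall j, is_series (fun i => u i j) (c j)) ->
  (forall i, is_series (fun j => Rabs (u i j)) (r' i)) ->
  (forall j, is_series (fun i => Rabs (u i j)) (c' j)) ->
  is_series r l -> is_series r' l' -> is_series c l.
Proof.
intros Hr Hc Hr' Hc' Hl Hl'.
assert (H1 : is_series c' l').
{ apply (is_series_tonelli (fun i j => Rabs (u i j)) r'); auto; intros; apply Rabs_pos. }
assert (H2 : is_series (fun j => c j + c' j) (l + l')).
{ apply (is_series_tonelli (fun i j => u i j + Rabs (u i j)) (fun i => r i + r' i)).
  - intros i j; pose proof (Rle_abs (- u i j)) as H; rewrite Rabs_Ropp in H; lra.
  - intros i; apply is_series_R_plus; auto.
  - intros j; now apply is_series_R_plus.
  - now apply is_series_R_plus. }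
refine (is_series_R_ext _ _ _ _ (is_series_R_minus _ _ _ _ H2 H1) _ _); [intros n|]; ring.
Qed.

Lemma is_series_R_tail (a : nat -> R) (l : R) :
  is_series a l -> is_series (fun n => a (S n)) (l - a 0%nat).
Proof.
intros H; apply is_series_incr_1; unfold plus; simpl.
replace (l - a 0%nat + a 0%nat) with l by ring; exact H.
Qed.

Lemma is_series_R_cons (a : nat -> R) (l : R) :
  is_series (fun n => a (S n)) l -> is_series a (a 0%nat + l).
Proof.
intros H; apply is_series_decr_1; unfold plus, opp; simpl.
replace (a 0%nat + l + - a 0%nat) with l by ring; exact H.
Qed.

Lemma pow_m1_sq n : (-1) ^ n * (-1) ^ n = 1.
Proof. rewrite <- Rpow_mult_distr; replace (-1 * -1) with 1 by ring; apply pow1. Qed.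

(** * The coefficients of P and the identity P(s) P(-s) = W(s) *)

Lemma is_series_bS p : (1 <= p)%nat ->
  is_series (fun k => beta (S k) / INR (S k) ^ p) (bS p).
Proof.
intros Hp; unfold bS, Series1.
rewrite (Series_ext _ (fun k => beta (S k) / INR (S k) ^ p)).
2:{ intros n; unfold beta; field.
    split; [apply pow_nonzero; lra|apply pow_nonzero, not_0_INR; lia]. }
apply Series_correct.
destruct p as [|p]; [lia|].
exists ((-1) ^ p * (gcoef 0 (S p) - gterm 0 (S p) 0)).
refine (is_series_R_ext _ _ _ _ (is_series_R_scal ((-1) ^ p) _ _ (is_series_R_tail _ _ (is_series_gterm 0 (S p)))) _ eq_refl).
intros k; unfold gterm.
change (INR 0) with 0; rewrite Rplus_0_l.
replace (INR (S k) ^ (p + 2)) with (INR (S k) * INR (S k) ^ S p) by (rewrite pow_add; simpl; ring).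
assert (INR (S k) <> 0) by (apply not_0_INR; lia).
pose proof (pow_m1_sq p) as E.
replace ((-1) ^ p * ((-1) ^ p * beta (S k) * INR (S k) / (INR (S k) * INR (S k) ^ S p)))
  with ((-1) ^ p * (-1) ^ p * beta (S k) * INR (S k) / (INR (S k) * INR (S k) ^ S p)) by (unfold Rdiv; ring).
rewrite E; field; split; [now apply pow_nonzero|assumption].
Qed.

Lemma gcoef_0_S p : gcoef 0 (S p) = (-1) ^ p * bS (S p).
Proof.
assert (G : is_series (gterm 0 (S p)) ((-1) ^ p * bS (S p))).
{ replace ((-1) ^ p * bS (S p)) with (gterm 0 (S p) 0 + (-1) ^ p * bS (S p)).
  - apply is_series_R_cons.
    refine (is_series_R_ext _ _ _ _ (is_series_R_scal ((-1) ^ p) _ _ (is_series_bS (S p) ltac:(lia))) _ eq_refl).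
    intros k; unfold gterm; change (INR 0) with 0; rewrite Rplus_0_l.
    replace (INR (S k) ^ (p + 2)) with (INR (S k) * INR (S k) ^ S p) by (rewrite pow_add; simpl; ring).
    assert (INR (S k) <> 0) by (apply not_0_INR; lia).
    field; split; [now apply pow_nonzero|assumption].
  - unfold gterm; change (INR 0) with 0; unfold Rdiv; ring. }
now apply is_series_unique in G.
Qed.

(** Degree 1 of [Bser_gcoef] says that B_1 + bS 1 = 0, and [theta_Bser] gives B_1 = -2 ln 2. *)
Lemma bS_1 : bS 1 = 2 * ln 2.
Proof.
pose proof (equal_f Bser_gcoef 1%nat) as H.
unfold fps_mul, PS_mult in H; simpl in H.
rewrite Bser_0, gcoef_0_S, gcoef_n_0, beta_0 in H.
pose proof (equal_f theta_Bser 1%nat) as K.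
unfold theta, fps_mul, PS_mult in K; simpl in K; rewrite Bser_0 in K.
replace (Bser_log 1) with (-2 * ln 2) in K.
2:{ unfold Bser_log, fps_add, fps_scale, theta, bell_arg, xC, xD, fps_x; simpl; field. }
replace (Bser_log 0) with 0 in K.
2:{ unfold Bser_log, fps_add, fps_scale, theta, fps_x; simpl; ring. }
unfold fps1 in H; simpl in H; lra.
Qed.

Lemma is_series_beta_add n : (0 < n)%nat ->
  is_series (fun l => beta (S l) / (INR n + INR (S l))) (/ (INR n * beta n) - / INR n).
Proof.
intros Hn; pose proof (is_series_gterm n 0) as H; rewrite gcoef_n_0 in H.
apply (is_series_R_scal (/ INR n)), is_series_R_tail in H.
assert (0 < INR n) by (now apply lt_0_INR); pose proof (beta_pos n).
refine (is_series_R_ext _ _ _ _ H _ _).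
- intros k; cbv beta; rewrite gterm_0_pos by assumption; pose proof (pos_INR (S k)); field; lra.
- rewrite gterm_0_pos, beta_0 by assumption; simpl (INR 0); field; lra.
Qed.

Lemma alternating_geometric (u v : R) m :
  (u + v) * sum_f_R0 (fun i => (-1) ^ i * u ^ i * v ^ (m - i)) m
  = v ^ S m + (-1) ^ m * u ^ S m.
Proof.
induction m as [|m IH]; [simpl; ring|].
rewrite tech5, Nat.sub_diag.
rewrite (sum_eq _ (fun i => ((-1) ^ i * u ^ i * v ^ (m - i)) * v)).
- rewrite <- scal_sum.
  replace ((u + v) * (v * sum_f_R0 (fun i => (-1) ^ i * u ^ i * v ^ (m - i)) m +
     (-1) ^ S m * u ^ S m * v ^ 0)) with (v * ((u + v) * sum_f_R0 (fun i => (-1) ^ i * u ^ i * v ^ (m - i)) m)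
     + (u + v) * ((-1) ^ S m * u ^ S m)) by (simpl (v ^ 0); ring).
  rewrite IH; simpl; ring.
- intros i Hi; replace (S m - i)%nat with (S (m - i)) by lia; simpl; ring.
Qed.

(** With U_k = 1/k, the alternating geometric sum and U_k U_l / (U_k + U_l) = 1 / (k + l) turn the
    left side into the double series of b_k b_l (U_k^(m+1) + U_l^(m+1)) / (k + l), the plus sign
    being due to m even. This is F(k,l) + F(l,k), whose halves have equal totals by Tonelli;
    [is_series_beta_add] gives F the row sums U_k^(m+2) (1 - b_k). *)
Lemma alternating_bS_sum m : Nat.even m = true ->
  sum_f_R0 (fun i => (-1) ^ i * bS (S i) * bS (S (m - i))) m
  = 2 * (zeta (m + 2) - bS (m + 2)).
Proof.
intros Hm.
assert (Em : (-1) ^ m = 1).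
{ apply Nat.even_spec in Hm; destruct Hm as [p ->]; apply pow_1_even. }
set (U := fun k => / INR (S k)).
pose (F := fun k l => beta (S k) * U k ^ S m * (beta (S l) / (INR (S k) + INR (S l)))).
pose (r := fun k => U k ^ (m + 2) - beta (S k) / INR (S k) ^ (m + 2)).
assert (HU : forall k, 0 < INR (S k)) by (intros k; apply lt_0_INR; lia).
assert (HF : forall k l, 0 <= F k l).
{ intros k l; pose proof (HU k); pose proof (HU l); pose proof (beta_pos (S k)); pose proof (beta_pos (S l)).
  apply Rmult_le_pos; [apply Rmult_le_pos; [lra|]|apply Rdiv_le_0_compat; lra].
  apply pow_le; left; now apply Rinv_0_lt_compat. }
assert (Hr : forall k, is_series (F k) (r k)).
{ intros k; refine (is_series_R_ext _ _ _ _ (is_series_R_scal _ _ _ (is_series_beta_add (S k) _)) (fun _ => eq_refl) _); [lia|].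
  pose proof (HU k); pose proof (beta_pos (S k)).
  unfold r, U; rewrite !pow_inv, !pow_add, <- tech_pow_Rmult.
  set (y := INR (S k)) in *; field.
  repeat split; try lra; apply pow_nonzero; lra. }
assert (HR : is_series r (zeta (m + 2) - bS (m + 2))).
{ apply is_series_R_minus; [|apply is_series_bS; lia].
  refine (is_series_R_ext _ _ _ _ (is_series_zeta (m + 2) ltac:(lia)) _ eq_refl).
  intros k; unfold U; now rewrite pow_inv. }
pose (c := fun l => Series (fun k => F k l)).
assert (Hc : forall l, is_series (fun k => F k l) (c l)).
{ intros l; apply Series_correct; now apply (ex_series_column F r (zeta (m + 2) - bS (m + 2))). }
pose proof (is_series_tonelli F r c _ HF Hr Hc HR) as HC.
assert (E : is_series (fun k => r k + c k)
             (sum_f_R0 (fun i => (-1) ^ i * bS (S i) * bS (S (m - i))) m)).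
{ assert (Hk : forall k, r k + c k
      = sum_f_R0 (fun i => (-1) ^ i * (beta (S k) / INR (S k) ^ S i) * bS (S (m - i))) m).
  { intros k.
    assert (H1 : is_series (fun l => F k l + F l k) (r k + c k)) by (apply is_series_R_plus; auto).
    assert (H2 : is_series (fun l => sum_f_R0 (fun i =>
        ((-1) ^ i * (beta (S k) / INR (S k) ^ S i)) * (beta (S l) / INR (S l) ^ S (m - i))) m)
       (sum_f_R0 (fun i => (-1) ^ i * (beta (S k) / INR (S k) ^ S i) * bS (S (m - i))) m)).
    { apply (is_series_sum_f_R0 (fun i l => ((-1) ^ i * (beta (S k) / INR (S k) ^ S i)) * (beta (S l) / INR (S l) ^ S (m - i)))).
      intros i _; apply is_series_R_scal, is_series_bS; lia. }
    rewrite <- (is_series_unique _ _ H1), <- (is_series_unique _ _ H2).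
    apply Series_ext; intros l.
    pose proof (alternating_geometric (U k) (U l) m) as G; rewrite Em, Rmult_1_l in G.
    rewrite (sum_eq _ (fun i => ((-1) ^ i * U k ^ i * U l ^ (m - i)) * (beta (S k) * beta (S l) * U k * U l))).
    2:{ intros i _; unfold Rdiv; rewrite <- !pow_inv, <- !tech_pow_Rmult; unfold U; ring. }
    rewrite <- scal_sum.
    pose proof (HU k); pose proof (HU l).
    assert (K : U k + U l <> 0).
    { unfold U; pose proof (Rinv_0_lt_compat _ H); pose proof (Rinv_0_lt_compat _ H0); lra. }
    replace (sum_f_R0 (fun i => (-1) ^ i * U k ^ i * U l ^ (m - i)) m)
      with ((U l ^ S m + U k ^ S m) / (U k + U l)) by (rewrite <- G; field; exact K).
    unfold F; set (x := U k ^ S m); set (y := U l ^ S m); unfold U; field; lra. }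
  refine (is_series_R_ext (fun k => sum_f_R0 (fun i => (-1) ^ i * (beta (S k) / INR (S k) ^ S i) * bS (S (m - i))) m)
     _ _ _ _ (fun k => eq_sym (Hk k)) eq_refl).
  apply (is_series_sum_f_R0 (fun i k => (-1) ^ i * (beta (S k) / INR (S k) ^ S i) * bS (S (m - i)))).
  intros i _.
  refine (is_series_R_ext _ _ _ _ (is_series_R_scal ((-1) ^ i * bS (S (m - i))) _ _ (is_series_bS (S i) ltac:(lia))) _ _);
    [intros n|]; ring. }
rewrite <- (is_series_unique _ _ E).
rewrite (is_series_unique _ _ (is_series_R_plus _ _ _ _ HR HC)); ring.
Qed.

(* [pi s cot (pi s)] *)
Definition Wser : nat -> R := fun n =>
  if (n =? 0)%nat then 1 else if Nat.even n then -2 * zeta n else 0.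

(* [1 - sum_j bS j s ^ j], which is [pi s cot (pi s) B (s)] *)
Definition Sser : nat -> R := fun n => if (n =? 0)%nat then 1 else - bS n.

Lemma Sser_scale : Sser = fps_scale (-1) (gcoef 0).
Proof.
extensionality n; unfold fps_scale; destruct n as [|p].
- rewrite gcoef_n_0, beta_0; unfold Sser; simpl; field.
- rewrite gcoef_0_S; unfold Sser; simpl Nat.eqb; cbv iota.
  replace ((-1) ^ S p * ((-1) ^ p * bS (S p))) with (- (((-1) ^ p * (-1) ^ p) * bS (S p))) by (simpl; ring).
  rewrite pow_m1_sq; ring.
Qed.

(** As [gcoef 0] is P(-s), the product is even in s and its odd coefficients vanish. In an even
    degree the two end terms of the Cauchy product, together -2 [bS], cancel the [bS] part of
    [alternating_bS_sum]. *)
Lemma Sser_gcoef : fps_mul Sser (gcoef 0) = Wser.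
Proof.
extensionality n; unfold Wser.
destruct n as [|n]; [rewrite fps_mul_0, gcoef_n_0, beta_0; unfold Sser; simpl; field|].
simpl (S n =? 0)%nat; cbv iota.
destruct (Nat.even (S n)) eqn:En.
- destruct n as [|m]; [discriminate|].
  change (Nat.even (S (S m))) with (Nat.even m) in En.
  rewrite fps_mul_Sl, fps_mul_Sr, gcoef_0_S, gcoef_n_0, beta_0.
  replace (fps_mul (fps_tail Sser) (fps_tail (gcoef 0)) m)
    with (- (2 * (zeta (m + 2) - bS (m + 2)))).
  + unfold fps_tail, Sser; simpl Nat.eqb; cbv iota.
    replace (m + 2)%nat with (S (S m)) by lia.
    replace ((-1) ^ S m) with (-1).
    * field.
    * apply Nat.even_spec in En; destruct En as [p ->]; rewrite pow_1_odd; reflexivity.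
  + rewrite <- alternating_bS_sum by assumption.
    unfold fps_mul, PS_mult.
    replace (- sum_f_R0 _ m) with (-1 * sum_f_R0 (fun i => (-1) ^ i * bS (S i) * bS (S (m - i))) m) by ring.
    rewrite scal_sum; apply sum_eq; intros i Hi.
    unfold fps_tail; rewrite gcoef_0_S; unfold Sser; simpl Nat.eqb; cbv iota.
    replace ((-1) ^ (m - i)) with ((-1) ^ i); [ring|].
    apply Nat.even_spec in En; destruct En as [p Hp].
    assert (E : (-1) ^ i * (-1) ^ (m - i) = 1).
    { rewrite <- pow_add; replace (i + (m - i))%nat with (2 * p)%nat by lia; apply pow_1_even. }
    pose proof (pow_m1_sq i) as E'.
    replace ((-1) ^ (m - i)) with ((-1) ^ i * ((-1) ^ i * (-1) ^ (m - i))); [rewrite E; ring|].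
    rewrite <- Rmult_assoc, E'; ring.
- assert (H : fps_scale (-1) (fps_mul Sser (gcoef 0)) = fps_mul Sser (gcoef 0)).
  { rewrite fps_scale_mul, <- Sser_scale, fps_mul_comm; f_equal.
    rewrite Sser_scale; extensionality k; unfold fps_scale.
    rewrite <- Rmult_assoc, <- Rpow_mult_distr; replace (-1 * -1) with 1 by ring; rewrite pow1; ring. }
  apply (f_equal (fun a => a (S n))) in H; unfold fps_scale in H.
  assert (On : Nat.odd (S n) = true) by (rewrite <- Nat.negb_even, En; reflexivity).
  apply Nat.odd_spec in On; destruct On as [p Hp].
  replace ((-1) ^ S n) with (-1) in H; [lra|].
  rewrite Hp, Nat.add_1_r, pow_1_odd; reflexivity.
Qed.

Lemma Bser_Wser : fps_mul Bser Wser = Sser.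
Proof.
rewrite <- Sser_gcoef.
transitivity (fps_mul Sser (fps_mul Bser (gcoef 0))); [ring|].
rewrite Bser_gcoef; ring.
Qed.

(** * Evaluation of the differentiated series *)

Lemma INR_S_pos n : 0 < INR (S n).
Proof. apply lt_0_INR; lia. Qed.

Lemma is_series_single (j : nat) (x : R) :
  is_series (fun n => if (n =? j)%nat then x else 0) x.
Proof.
assert (Z : is_series (fun _ : nat => 0) 0).
{ refine (is_series_R_ext _ _ _ _ (is_series_telescope (fun _ => 0) 0 (is_lim_seq_const _)) _ _);
  [intros n|]; ring. }
induction j as [|j IH].
- refine (is_series_R_ext _ _ _ _ (is_series_R_cons (fun n => if (n =? 0)%nat then x else 0) 0 Z)
    (fun _ => eq_refl) _); simpl; ring.
- refine (is_series_R_ext _ _ _ _ (is_series_R_cons (fun n => if (n =? S j)%nat then x else 0) x IH)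
    (fun _ => eq_refl) _); simpl; ring.
Qed.

Lemma is_lim_seq_inv_shift (c : R) : is_lim_seq (fun n => / (INR (S n) - c)) 0.
Proof.
replace (Finite 0) with (Rbar_inv p_infty) by reflexivity.
apply is_lim_seq_inv; [|easy].
apply is_lim_seq_minus with p_infty c; [|apply is_lim_seq_const|reflexivity].
apply (is_lim_seq_incr_1 INR), is_lim_seq_INR.
Qed.

Lemma is_lim_seq_opp_0 (u : nat -> R) :
  is_lim_seq u 0 -> is_lim_seq (fun n => - u n) 0.
Proof.
intros H; apply is_lim_seq_opp in H; simpl in H; now rewrite Ropp_0 in H.
Qed.

Lemma is_lim_seq_Rabs_0 (u : nat -> R) :
  is_lim_seq u 0 -> is_lim_seq (fun n => Rabs (u n)) 0.
Proof.
intros H; apply is_lim_seq_abs in H; simpl in H; now rewrite Rabs_R0 in H.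
Qed.

(** This is B'(n): with psi the digamma function, B'/B at s is 2 psi(1 + 2s) - 2 psi(1 + s) - 2 ln
    2, and the Euler constants cancel. *)
Definition beta_deriv (n : nat) : R := 2 * beta n * (harmonic (2 * n) - harmonic n - ln 2).

(** The derivative at s = n of (s + 1) B(s + 1) = (s + 1/2) B(s). *)
Lemma beta_deriv_S n :
  INR (S n) * beta_deriv (S n) = (INR n + / 2) * beta_deriv n + beta n - beta (S n).
Proof.
unfold beta_deriv; replace (2 * S n)%nat with (S (S (2 * n))) by lia.
rewrite !harmonic_S, beta_S_div.
rewrite !S_INR, mult_INR; simpl (INR 2); pose proof (pos_INR n); field; lra.
Qed.

(* The term [k = n] vanishes because [/ 0 = 0]; this convention is also used in
   the sums over [n] below. *)
Lemma is_series_beta_sub n :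
  is_series (fun k => beta k * / (INR n - INR k)) (beta_deriv n).
Proof.
induction n as [|n IH].
- unfold beta_deriv; rewrite !harmonic_zsum; simpl (2 * 0)%nat; rewrite zsum_0, beta_0.
  replace (2 * 1 * (0 - 0 - ln 2)) with (beta 0 * / (INR 0 - INR 0) + -1 * bS 1)
    by (rewrite bS_1; simpl; rewrite Rminus_0_r, Rinv_0; ring).
  apply is_series_R_cons.
  refine (is_series_R_ext _ _ _ _ (is_series_R_scal (-1) _ _ (is_series_bS 1 (le_n 1))) _ eq_refl).
  intros k; pose proof (INR_S_pos k); change (INR 0) with 0; field; lra.
(* For k other than n and n + 1, (n + 1) b_k / (n + 1 - k) = (n + 1/2) b_k / (n - k) - (e_(k+1) -
   e_k). At those two k the inverse of 0 leaves defects b_n and -b_(n+1), which are exactly the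
   inhomogeneous terms of [beta_deriv_S]. *)
- pose (e := fun k => beta k * INR k * / (INR (S n) - INR k)).
  assert (He : is_lim_seq e 0).
  { replace 0 with (0 * (-1 + INR (S n) * 0)) by ring.
    apply is_lim_seq_incr_1.
    apply is_lim_seq_ext_loc with
      (fun k => beta (S k) * (-1 + - INR (S n) * / (INR (S k) - INR (S n)))).
    - exists (S n); intros k Hk; unfold e.
      assert (INR (S n) < INR (S k)) by (apply lt_INR; lia); field; lra.
    - apply is_lim_seq_mult'; [apply (is_lim_seq_incr_1 beta), beta_lim|].
      apply is_lim_seq_plus'; [apply is_lim_seq_const|].
      replace (Finite (INR (S n) * 0)) with (Finite (- INR (S n) * 0)) by (f_equal; ring).
      apply (is_lim_seq_scal_l _ (- INR (S n)) 0), is_lim_seq_inv_shift. }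
  pose proof (is_series_R_minus _ _ _ _ (is_series_R_plus _ _ _ _
      (is_series_R_minus _ _ _ _ (is_series_R_scal (INR n + / 2) _ _ IH) (is_series_telescope e 0 He))
      (is_series_single n (beta n))) (is_series_single (S n) (beta (S n)))) as H.
  apply (is_series_R_scal (/ INR (S n))) in H.
  pose proof (INR_S_pos n).
  refine (is_series_R_ext _ _ _ _ H _ _).
  + intros k; cbv beta; unfold e; rewrite beta_S_div.
    pose proof (INR_S_pos k).
    destruct (Nat.eqb_spec k n) as [->|Hn]; [|destruct (Nat.eqb_spec k (S n)) as [->|Hn']].
    * replace (n =? S n)%nat with false by (symmetry; apply Nat.eqb_neq; lia).
      rewrite !Rminus_diag, Rinv_0, S_INR in *; field; lra.
    * rewrite !Rminus_diag, Rinv_0, (S_INR (S n)), S_INR in *; pose proof (beta_S_div n).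
      field; lra.
    * assert (INR n - INR k <> 0) by (apply Rminus_eq_contra, not_INR; lia).
      assert (INR (S n) - INR k <> 0) by (apply Rminus_eq_contra, not_INR; lia).
      rewrite !S_INR in *; field; repeat split; lra.
  + apply Rmult_eq_reg_l with (INR (S n)); [|lra].
    rewrite beta_deriv_S; unfold e; change (INR 0) with 0; field; lra.
Qed.

(** The sum over n >= 1 of 1 / (n^(p+1) (n + k)), reduced in p by partial fractions. *)
Fixpoint plus_sum (p k : nat) : R :=
  match p with
  | O => harmonic k / INR k
  | S p' => (zeta (S p) - plus_sum p' k) / INR k
  end.

(** The sum over n >= 1, n <> k, of 1 / (n^(p+1) (n - k)). Partial fractions fail at n = k, where
    the convention for the inverse of 0 leaves -1 / k^(p+2); the last summand of the second case
    restores this, as does one of the two 1 / k in the first. *)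
Fixpoint minus_sum (p k : nat) : R :=
  match p with
  | O => (2 / INR k - harmonic k) / INR k
  | S p' => (minus_sum p' k - zeta (S p)) / INR k + / INR k ^ (p + 2)
  end.

Lemma plus_sum_S p k : plus_sum (S p) k = (zeta (S (S p)) - plus_sum p k) / INR k.
Proof. reflexivity. Qed.

Lemma minus_sum_S p k :
  minus_sum (S p) k = (minus_sum p k - zeta (S (S p))) / INR k + / INR k ^ (S p + 2).
Proof. reflexivity. Qed.

(** In this series and the next two, raising k by one adds a telescoping difference that leaves a
    single boundary term. *)
Lemma is_series_inv_diff_plus k :
  is_series (fun n => / INR (S n) - / (INR (S n) + INR k)) (harmonic k).
Proof.
induction k as [|k IH].
- rewrite harmonic_zsum, zsum_0.
  refine (is_series_R_ext _ _ _ _ (is_series_single 0 0) _ eq_refl).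
  intros n; change (INR 0) with 0; rewrite Rplus_0_r; destruct (n =? 0)%nat; ring.
- rewrite harmonic_S.
  assert (L : is_lim_seq (fun n => - / (INR (S n) - - INR k)) 0).
  { apply is_lim_seq_opp_0, is_lim_seq_inv_shift. }
  refine (is_series_R_ext _ _ _ _ (is_series_R_plus _ _ _ _ IH (is_series_telescope _ 0 L)) _ _).
  + intros n; cbv beta; rewrite !S_INR; pose proof (pos_INR n); pose proof (pos_INR k); field; lra.
  + cbv beta; rewrite !S_INR; change (INR 0) with 0; pose proof (pos_INR k); field; lra.
Qed.

Lemma is_series_inv_diff_minus k : (0 < k)%nat ->
  is_series (fun n => / (INR (S n) - INR k) - / INR (S n)) (/ INR k - harmonic k).
Proof.
destruct k as [|k]; [lia|intros _].
induction k as [|k IH].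
- rewrite harmonic_S, harmonic_zsum, zsum_0.
  pose proof (is_series_telescope (fun n => - / (INR (S n) - 1)) 0) as H.
  refine (is_series_R_ext _ _ _ _ (H _) _ _).
  + apply is_lim_seq_opp_0, is_lim_seq_inv_shift.
  + intros n; rewrite (S_INR (S n)); simpl (INR 1).
    replace (INR (S n) + 1 - 1) with (INR (S n)) by ring; ring.
  + simpl; rewrite Rminus_diag, Rinv_0; field.
- rewrite harmonic_S.
  assert (L : is_lim_seq (fun n => - / (INR (S n) - INR (S (S k)))) 0).
  { apply is_lim_seq_opp_0, is_lim_seq_inv_shift. }
  refine (is_series_R_ext _ _ _ _ (is_series_R_plus _ _ _ _ IH (is_series_telescope _ 0 L)) _ _).
  + intros n; cbv beta; rewrite (S_INR (S n)), (S_INR (S k)).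
    replace (INR (S n) + 1 - (INR (S k) + 1)) with (INR (S n) - INR (S k)) by ring; ring.
  + cbv beta; pose proof (INR_S_pos k); rewrite (S_INR (S k)); simpl (INR 1).
    replace (1 - (INR (S k) + 1)) with (- INR (S k)) by ring; field; lra.
Qed.

Lemma is_series_abs_inv_diff k :
  is_series (fun n => Rabs (/ (INR (S n) - INR (S k))) - / INR (S n)) (harmonic k).
Proof.
induction k as [|k IH].
- rewrite harmonic_zsum, zsum_0.
  pose proof (is_series_telescope (fun n => - Rabs (/ (INR (S n) - 1))) 0) as H.
  refine (is_series_R_ext _ _ _ _ (H _) _ _).
  + apply is_lim_seq_opp_0, is_lim_seq_Rabs_0, is_lim_seq_inv_shift.
  + intros n; rewrite (S_INR (S n)); simpl (INR 1).
    replace (INR (S n) + 1 - 1) with (INR (S n)) by ring.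
    rewrite (Rabs_pos_eq (/ INR (S n))); [ring|].
    left; apply Rinv_0_lt_compat, INR_S_pos.
  + simpl; rewrite Rminus_diag, Rinv_0, Rabs_R0; ring.
- rewrite harmonic_S.
  assert (L : is_lim_seq (fun n => - Rabs (/ (INR (S n) - INR (S (S k))))) 0).
  { apply is_lim_seq_opp_0, is_lim_seq_Rabs_0, is_lim_seq_inv_shift. }
  refine (is_series_R_ext _ _ _ _ (is_series_R_plus _ _ _ _ IH (is_series_telescope _ 0 L)) _ _).
  + intros n; cbv beta; rewrite (S_INR (S n)), (S_INR (S k)).
    replace (INR (S n) + 1 - (INR (S k) + 1)) with (INR (S n) - INR (S k)) by ring; ring.
  + cbv beta; pose proof (INR_S_pos k) as Hk; rewrite (S_INR (S k)); simpl (INR 1).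
    replace (1 - (INR (S k) + 1)) with (- INR (S k)) by ring.
    rewrite Rinv_opp, Rabs_Ropp, Rabs_pos_eq; [ring|].
    left; now apply Rinv_0_lt_compat.
Qed.

Lemma is_series_plus_sum p k : (0 < k)%nat ->
  is_series (fun n => / (INR (S n) ^ S p * (INR (S n) + INR k))) (plus_sum p k).
Proof.
intros Hk; assert (0 < INR k) by (now apply lt_0_INR).
induction p as [|p IH].
- refine (is_series_R_ext _ _ _ _ (is_series_R_scal (/ INR k) _ _ (is_series_inv_diff_plus k)) _ _).
  + intros n; pose proof (INR_S_pos n); rewrite pow_1; field; lra.
  + simpl; field; lra.
- refine (is_series_R_ext _ _ _ _ (is_series_R_scal (/ INR k) _ _
     (is_series_R_minus _ _ _ _ (is_series_zeta (S (S p)) ltac:(lia)) IH)) _ _).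
  + intros n; cbv beta; pose proof (INR_S_pos n); rewrite <- !tech_pow_Rmult.
    field; repeat split; try lra; apply pow_nonzero; lra.
  + rewrite plus_sum_S; field; lra.
Qed.

Lemma is_series_minus_sum p k : (0 < k)%nat ->
  is_series (fun n => / INR (S n) ^ S p * / (INR (S n) - INR k)) (minus_sum p k).
Proof.
intros Hk; assert (0 < INR k) by (now apply lt_0_INR).
induction p as [|p IH].
- refine (is_series_R_ext _ _ _ _ (is_series_R_plus _ _ _ _
     (is_series_R_scal (/ INR k) _ _ (is_series_inv_diff_minus k Hk))
     (is_series_single (k - 1) (/ INR k ^ 2))) _ _).
  + intros n; cbv beta; pose proof (INR_S_pos n).
    destruct (Nat.eqb_spec n (k - 1)) as [En|En].
    * replace (S n) with k in * by lia; rewrite Rminus_diag, Rinv_0; field; lra.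
    * assert (INR (S n) - INR k <> 0) by (apply Rminus_eq_contra, not_INR; lia).
      rewrite pow_1; field; lra.
  + simpl; field; lra.
- refine (is_series_R_ext _ _ _ _ (is_series_R_plus _ _ _ _
     (is_series_R_scal (/ INR k) _ _ (is_series_R_minus _ _ _ _ IH (is_series_zeta (S (S p)) ltac:(lia))))
     (is_series_single (k - 1) (/ INR k ^ (S p + 2)))) _ _).
  + intros n; cbv beta; pose proof (INR_S_pos n).
    destruct (Nat.eqb_spec n (k - 1)) as [En|En].
    * replace (S n) with k in * by lia; rewrite Rminus_diag, Rinv_0, pow_add, <- !tech_pow_Rmult.
      field; repeat split; try lra; apply pow_nonzero; lra.
    * assert (INR (S n) - INR k <> 0) by (apply Rminus_eq_contra, not_INR; lia).
      rewrite <- !tech_pow_Rmult; field; repeat split; try lra; apply pow_nonzero; lra.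
  + rewrite minus_sum_S; field; split; [apply pow_nonzero; lra|lra].
Qed.

(* The harmonic numbers cancel in this combination. *)
Lemma minus_sum_plus_sum p k : (0 < k)%nat ->
  minus_sum p k - (-1) ^ S p * plus_sum p k
  = INR (S p) / INR k ^ (p + 2)
    + sum_f_R0 (fun j => Wser j / INR k ^ (p + 2 - j)) (S p).
Proof.
intros Hk; assert (H : 0 < INR k) by (now apply lt_0_INR).
(* Raising p by one brings in [zeta (p + 2)] from both sums; the contributions add or cancel
   according to parity, which is the pattern of [Wser]. *)
assert (W : forall j, Wser (S (S j)) = - (1 + (-1) ^ j) * zeta (S (S j))).
{ intros j; unfold Wser; simpl Nat.eqb; cbv iota.
  change (Nat.even (S (S j))) with (Nat.even j).
  destruct (Nat.even j) eqn:Ej.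
  - apply Nat.even_spec in Ej; destruct Ej as [m ->]; rewrite pow_1_even; ring.
  - assert (Oj : Nat.odd j = true) by (rewrite <- Nat.negb_even, Ej; reflexivity).
    apply Nat.odd_spec in Oj; destruct Oj as [m ->]; rewrite Nat.add_1_r, pow_1_odd; ring. }
induction p as [|p IH].
- unfold Wser; simpl; field; lra.
- rewrite tech5.
  rewrite (sum_eq _ (fun j => (Wser j / INR k ^ (p + 2 - j)) * / INR k)).
  + rewrite <- scal_sum.
    replace (S p + 2 - S (S p))%nat with 1%nat by lia.
    rewrite W, pow_1; rewrite minus_sum_S, plus_sum_S.
    replace (sum_f_R0 (fun j => Wser j / INR k ^ (p + 2 - j)) (S p)) with
      (minus_sum p k - (-1) ^ S p * plus_sum p k - INR (S p) / INR k ^ (p + 2)) by (rewrite IH; ring).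
    rewrite (S_INR (S p)), <- !tech_pow_Rmult.
    change (S p + 2)%nat with (S (p + 2)); rewrite <- tech_pow_Rmult.
    field; repeat split; try lra; apply pow_nonzero; lra.
  + intros j Hj; replace (S p + 2 - j)%nat with (S (p + 2 - j)) by lia.
    rewrite <- tech_pow_Rmult; field; repeat split; try lra; apply pow_nonzero; lra.
Qed.

(** * Convergence, domination and the exchange of summations *)

Lemma is_series_bSt p : (2 <= p)%nat ->
  is_series (fun n => / (INR (S n) ^ p * beta (S n))) (bSt p).
Proof.
intros Hp; unfold bSt, Series1.
rewrite (Series_ext _ (fun n => / (INR (S n) ^ p * beta (S n)))).
2:{ intros n; pose proof (beta_pos (S n)) as Hb; unfold beta in *; pose proof (INR_S_pos n).
    assert (0 < 4 ^ S n) by (apply pow_lt; lra).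
    assert (central_binom (S n) <> 0).
    { intros Z; rewrite Z in Hb; unfold Rdiv in Hb; lra. }
    field; repeat split; try lra; apply pow_nonzero; lra. }
apply Series_correct.
(* A decreasing sequence whose differences are a_n / (2y + 1) with y = n + 1. The factor 3 used
   below comes from 2y + 1 <= 3y for y >= 1. *)
pose (a := fun n => / (INR (S n) * beta (S n))).
assert (Ha : forall n, a n - a (S n) = a n / (2 * INR (S n) + 1)).
{ intros n; unfold a; pose proof (INR_S_pos n); pose proof (beta_pos (S n)).
  rewrite (beta_S_div (S n)), (S_INR (S n)); field; lra. }
assert (Hpos : forall n, 0 < a n).
{ intros n; apply Rinv_0_lt_compat, Rmult_lt_0_compat; [apply INR_S_pos|apply beta_pos]. }
destruct (ex_finite_lim_seq_decr a 0) as [l Hl].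
{ intros n; pose proof (Ha n); pose proof (INR_S_pos n).
  assert (0 <= a n / (2 * INR (S n) + 1)) by (apply Rdiv_le_0_compat; [left; apply Hpos|lra]); lra. }
{ intros n; left; apply Hpos. }
apply (ex_series_le (K := R_AbsRing) (V := R_CompleteNormedModule) _
  (fun n => -3 * (a (S n) - a n))).
- intros n; change (Rabs (/ (INR (S n) ^ p * beta (S n))) <= -3 * (a (S n) - a n)).
  replace (-3 * (a (S n) - a n)) with (3 * (a n - a (S n))) by ring.
  rewrite Ha; unfold a; pose proof (beta_pos (S n)).
  assert (1 <= INR (S n)) by (rewrite S_INR; pose proof (pos_INR n); lra).
  set (y := INR (S n)) in *.
  assert (0 < y ^ p) by (apply pow_lt; lra).
  rewrite Rabs_pos_eq by (left; apply Rinv_0_lt_compat, Rmult_lt_0_compat; lra).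
  apply Rle_trans with (/ (y ^ 2 * beta (S n))).
  + apply Rinv_le_contravar; [apply Rmult_lt_0_compat; [apply pow_lt|]; lra|].
    apply Rmult_le_compat_r; [lra|]; apply Rle_pow; [lra|assumption].
  + replace (3 * (/ (y * beta (S n)) / (2 * y + 1)))
      with (/ (y * ((2 * y + 1) / 3) * beta (S n))) by (field; lra).
    apply Rinv_le_contravar; [apply Rmult_lt_0_compat; nra|].
    apply Rmult_le_compat_r; [lra|nra].
- eexists; apply is_series_R_scal, is_series_telescope, Hl.
Qed.

(** Tonelli: summing over k first uses [is_series_beta_add], summing over n first gives [plus_sum].
    The case p = 0 also serves as majorant for series weighted by harmonic numbers. *)
Lemma is_series_beta_plus_sum p :
  is_series (fun k => beta (S k) * plus_sum p (S k)) (bSt (p + 2) - zeta (p + 2)).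
Proof.
apply (is_series_tonelli (fun n k => / INR (S n) ^ S p * (beta (S k) / (INR (S n) + INR (S k))))
  (fun n => / (INR (S n) ^ (p + 2) * beta (S n)) - / INR (S n) ^ (p + 2))).
- intros n k; pose proof (INR_S_pos n); pose proof (INR_S_pos k); pose proof (beta_pos (S k)).
  apply Rmult_le_pos; [left; apply Rinv_0_lt_compat, pow_lt; lra|apply Rdiv_le_0_compat; lra].
- intros n; refine (is_series_R_ext _ _ _ _ (is_series_R_scal (/ INR (S n) ^ S p) _ _
    (is_series_beta_add (S n) ltac:(lia))) (fun _ => eq_refl) _).
  pose proof (INR_S_pos n); pose proof (beta_pos (S n)).
  rewrite pow_add, <- tech_pow_Rmult; field; repeat split; try lra; apply pow_nonzero; lra.
- intros k; refine (is_series_R_ext _ _ _ _ (is_series_R_scal (beta (S k)) _ _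
    (is_series_plus_sum p (S k) ltac:(lia))) _ eq_refl).
  intros n; pose proof (INR_S_pos n); pose proof (INR_S_pos k).
  field; split; [lra|apply pow_nonzero; lra].
- apply is_series_R_minus; [apply is_series_bSt; lia|apply is_series_zeta; lia].
Qed.

Lemma harmonic_ge_0 n : 0 <= harmonic n.
Proof.
induction n as [|n IH]; [rewrite harmonic_zsum, zsum_0; lra|].
rewrite harmonic_S; pose proof (Rinv_0_lt_compat _ (INR_S_pos n)); lra.
Qed.

Lemma is_series_bS1 q : (1 <= q)%nat ->
  is_series (fun k => harmonic (S k) * (beta (S k) / INR (S k) ^ q)) (bS1 q).
Proof.
intros Hq; unfold bS1, Series1.
rewrite (Series_ext _ (fun k => harmonic (S k) * (beta (S k) / INR (S k) ^ q))).
2:{ intros n; unfold beta; pose proof (INR_S_pos n); field.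
    split; apply pow_nonzero; lra. }
apply Series_correct.
apply (ex_series_le (K := R_AbsRing) (V := R_CompleteNormedModule) _
  (fun k => beta (S k) * plus_sum 0 (S k))).
- intros k; change (Rabs (harmonic (S k) * (beta (S k) / INR (S k) ^ q)) <= beta (S k) * plus_sum 0 (S k)).
  change (plus_sum 0 (S k)) with (harmonic (S k) / INR (S k)); pose proof (harmonic_ge_0 (S k)); pose proof (beta_pos (S k)).
  assert (1 <= INR (S k)) by (rewrite S_INR; pose proof (pos_INR k); lra).
  assert (INR (S k) <= INR (S k) ^ q).
  { rewrite <- (pow_1 (INR (S k))) at 1; apply Rle_pow; [lra|assumption]. }
  rewrite Rabs_pos_eq by (apply Rmult_le_pos; [lra|apply Rdiv_le_0_compat; lra]).
  replace (beta (S k) * (harmonic (S k) / INR (S k))) with (harmonic (S k) * (beta (S k) * / INR (S k)))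
    by (field; lra).
  apply Rmult_le_compat_l; [lra|]; apply Rmult_le_compat_l; [lra|].
  apply Rinv_le_contravar; lra.
- eexists; apply is_series_beta_plus_sum.
Qed.

(** The majorant has a closed sum over x = n. For x > y its first part already equals 1 / (x (x -
    y)); for x < y it falls short by 2 / (x y), which 4 / (x (x + y)) covers because x + y < 2y;
    this fixes the constant 4. *)
Lemma Rabs_minus_term_le (x y : R) p : 1 <= x -> 0 < y ->
  Rabs (/ x ^ S p * / (x - y)) <= / y * (Rabs (/ (x - y)) - / x) + 4 * / (x ^ 1 * (x + y)).
Proof.
intros Hx Hy.
assert (Hpow : 0 < / x ^ S p <= / x).
{ assert (0 < x ^ S p) by (apply pow_lt; lra).
  split; [now apply Rinv_0_lt_compat|]; apply Rinv_le_contravar; [lra|].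
  rewrite <- (pow_1 x) at 1; apply Rle_pow; [lra|lia]. }
rewrite Rabs_mult, (Rabs_pos_eq (/ x ^ S p)), pow_1 by lra.
apply Rle_trans with (/ x * Rabs (/ (x - y))); [apply Rmult_le_compat_r; [apply Rabs_pos|lra]|].
destruct (Rtotal_order x y) as [L|[->|L]].
- rewrite Rabs_left by (apply Rinv_lt_0_compat; lra).
  assert (E : / y * (- / (x - y) - / x) + 4 * / (x * (x + y)) - / x * - / (x - y)
     = 2 * (y - x) * / (x * y * (x + y))) by (field; lra).
  assert (0 < / (x * y * (x + y))) by (apply Rinv_0_lt_compat; repeat apply Rmult_lt_0_compat; lra).
  nra.
- rewrite Rminus_diag, Rinv_0, Rabs_R0.
  replace (/ y * (0 - / y) + 4 * / (y * (y + y))) with (/ (y * y)) by (field; lra).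
  rewrite Rmult_0_r; left; apply Rinv_0_lt_compat; nra.
- rewrite Rabs_pos_eq by (left; apply Rinv_0_lt_compat; lra).
  replace (/ y * (/ (x - y) - / x)) with (/ x * / (x - y)) by (field; lra).
  assert (0 < / (x * (x + y))) by (apply Rinv_0_lt_compat; nra); lra.
Qed.

(** Fubini over k >= 1. The term k = 0 of [is_series_beta_sub] is 1/n and accounts for the added
    zeta value. *)
Lemma is_series_beta_deriv p l :
  is_series (fun k => beta (S k) * minus_sum p (S k)) l ->
  is_series (fun n => beta_deriv (S n) / INR (S n) ^ S p) (l + zeta (p + 2)).
Proof.
intros Hl.
pose (u := fun k n => beta (S k) * (/ INR (S n) ^ S p * / (INR (S n) - INR (S k)))).
pose (v := fun k n => beta (S k) * (/ INR (S k) * (Rabs (/ (INR (S n) - INR (S k))) - / INR (S n))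
            + 4 * / (INR (S n) ^ 1 * (INR (S n) + INR (S k))))).
assert (Huv : forall k n, Rabs (u k n) <= v k n).
{ intros k n; unfold u, v; pose proof (beta_pos (S k)).
  rewrite Rabs_mult, (Rabs_pos_eq (beta _)) by lra; apply Rmult_le_compat_l; [lra|].
  apply Rabs_minus_term_le; [rewrite S_INR; pose proof (pos_INR n); lra|apply INR_S_pos]. }
assert (Hv : forall k, is_series (v k) (beta (S k) * (/ INR (S k) * harmonic k + 4 * plus_sum 0 (S k)))).
{ intros k; apply is_series_R_scal, is_series_R_plus; apply is_series_R_scal.
  - apply is_series_abs_inv_diff.
  - apply is_series_plus_sum; lia. }
pose (r' := fun k => Series (fun n => Rabs (u k n))).
assert (Hr' : forall k, is_series (fun n => Rabs (u k n)) (r' k)).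
{ intros k; apply Series_correct.
  apply (ex_series_le (K := R_AbsRing) (V := R_CompleteNormedModule) _ (v k)).
  - intros n; change (Rabs (Rabs (u k n)) <= v k n); rewrite Rabs_Rabsolu; apply Huv.
  - eexists; apply Hv. }
(* The constant 5 is 1 + 4: H_k / (k + 1) is at most [plus_sum 0 (S k)], and four more copies come
   from the majorant [v]. *)
assert (Hl' : ex_series r').
{ apply (ex_series_le (K := R_AbsRing) (V := R_CompleteNormedModule) _
    (fun k => 5 * (beta (S k) * plus_sum 0 (S k)))).
  - intros k; change (Rabs (r' k) <= 5 * (beta (S k) * plus_sum 0 (S k))).
    rewrite Rabs_pos_eq.
    + apply Rle_trans with (beta (S k) * (/ INR (S k) * harmonic k + 4 * plus_sum 0 (S k))).
      * exact (is_series_le _ _ _ _ (Huv k) (Hr' k) (Hv k)).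
      * change (plus_sum 0 (S k)) with (harmonic (S k) / INR (S k)); rewrite harmonic_S; pose proof (beta_pos (S k)); pose proof (INR_S_pos k).
        pose proof (Rinv_0_lt_compat _ H0).
        replace (5 * (beta (S k) * ((harmonic k + / INR (S k)) / INR (S k)))) with
          (beta (S k) * (/ INR (S k) * harmonic k + 4 * ((harmonic k + / INR (S k)) / INR (S k)))
            + beta (S k) * (/ INR (S k) * / INR (S k))) by (field; lra).
        assert (0 <= beta (S k) * (/ INR (S k) * / INR (S k))); [|lra].
        apply Rmult_le_pos; [lra|nra].
    + refine (Rle_trans _ _ _ _ (sum_n_le_is_series _ _ 0 (fun n => Rabs_pos (u k n)) (Hr' k))).
      rewrite sum_O; apply Rabs_pos.
  - eexists; apply is_series_R_scal, is_series_beta_plus_sum. }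
destruct Hl' as [l' Hl'].
assert (HC : is_series (fun n => / INR (S n) ^ S p * (beta_deriv (S n) - / INR (S n))) l).
{ apply (is_series_fubini u (fun k => beta (S k) * minus_sum p (S k)) r'
      (fun n => / INR (S n) ^ S p * (beta_deriv (S n) - / INR (S n)))
      (fun n => Series (fun k => Rabs (u k n))) l l'); auto.
  - intros k; apply is_series_R_scal, is_series_minus_sum; lia.
  - intros n; refine (is_series_R_ext _ _ _ _ (is_series_R_scal (/ INR (S n) ^ S p) _ _
      (is_series_R_tail _ _ (is_series_beta_sub (S n)))) _ _).
    + intros k; unfold u; ring.
    + rewrite beta_0; change (INR 0) with 0; rewrite Rminus_0_r, Rmult_1_l; reflexivity.
  - intros n; apply Series_correct.
    apply (ex_series_column (fun k n => Rabs (u k n)) r' l'); auto; intros; apply Rabs_pos. }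
refine (is_series_R_ext _ _ _ _ (is_series_R_plus _ _ _ _ HC (is_series_zeta (p + 2) ltac:(lia))) _ eq_refl).
intros n; cbv beta; pose proof (INR_S_pos n); rewrite pow_add, <- tech_pow_Rmult.
field; repeat split; try lra; apply pow_nonzero; lra.
Qed.

(** The terms k = 0 of the two transforms give (1 + (-1)^p) [zeta (p + 2)], which is -W_(p+2): the
    top term of the convolution, where P has its constant coefficient 1. *)
Lemma is_series_beta_deriv_eval p :
  is_series (fun n => beta_deriv (S n) / INR (S n) ^ S p)
    (INR (S p) * bS (p + 2) + (-1) ^ S p * bSt (p + 2) - fps_mul Wser Sser (p + 2)).
Proof.
assert (E : is_series (fun k => beta (S k) * minus_sum p (S k))
   ((INR (S p) * bS (p + 2) + sum_f_R0 (fun j => Wser j * bS (p + 2 - j)) (S p))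
     + (-1) ^ S p * (bSt (p + 2) - zeta (p + 2)))).
{ refine (is_series_R_ext _ _ _ _ (is_series_R_plus _ _ _ _ (is_series_R_plus _ _ _ _
     (is_series_R_scal (INR (S p)) _ _ (is_series_bS (p + 2) ltac:(lia)))
     (is_series_sum_f_R0 (fun j k => Wser j * (beta (S k) / INR (S k) ^ (p + 2 - j)))
         (fun j => Wser j * bS (p + 2 - j)) (S p) _))
     (is_series_R_scal ((-1) ^ S p) _ _ (is_series_beta_plus_sum p))) _ eq_refl).
  - intros j Hj; apply is_series_R_scal, is_series_bS; lia.
  - intros k; cbv beta.
    replace (minus_sum p (S k)) with
      (minus_sum p (S k) - (-1) ^ S p * plus_sum p (S k) + (-1) ^ S p * plus_sum p (S k)) by ring.
    rewrite minus_sum_plus_sum by lia.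
    rewrite (sum_eq (fun j => Wser j * (beta (S k) / INR (S k) ^ (p + 2 - j)))
       (fun j => (Wser j / INR (S k) ^ (p + 2 - j)) * beta (S k))) by (intros; unfold Rdiv; ring).
    rewrite <- scal_sum; unfold Rdiv; ring. }
apply is_series_beta_deriv in E.
refine (is_series_R_ext _ _ _ _ E (fun _ => eq_refl) _).
replace (p + 2)%nat with (S (S p)) by lia.
unfold fps_mul, PS_mult; rewrite (tech5 _ (S p)), Nat.sub_diag.
rewrite (sum_eq (fun k => Wser k * Sser (S (S p) - k)) (fun j => (Wser j * bS (S (S p) - j)) * (-1))).
2:{ intros j Hj; unfold Sser.
    replace (S (S p) - j =? 0)%nat with false by (symmetry; apply Nat.eqb_neq; lia); ring. }
rewrite <- scal_sum; unfold Sser; simpl (0 =? 0)%nat; cbv iota.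
replace (Wser (S (S p))) with (if Nat.even p then -2 * zeta (S (S p)) else 0) by reflexivity.
destruct (Nat.even p) eqn:Ej.
- apply Nat.even_spec in Ej; destruct Ej as [m ->]; rewrite pow_1_odd; ring.
- assert (Oj : Nat.odd p = true) by (rewrite <- Nat.negb_even, Ej; reflexivity).
  apply Nat.odd_spec in Oj; destruct Oj as [m ->]; replace (S (2 * m + 1)) with (2 * S m)%nat by lia.
  rewrite pow_1_even; ring.
Qed.

(** * Assembling the sums over tuples *)

(* [sum_n_ext] leaves equations at [R_AbelianMonoid], which [ring] does not recognise. *)
Ltac ring_R := lazymatch goal with |- @eq _ ?x ?y => change (@eq R x y) end; ring.

Lemma sum_n_R_S (f : nat -> R) n : sum_n f (S n) = sum_n f n + f (S n).
Proof. apply (sum_Sn (G := R_AbelianMonoid)). Qed.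

Lemma sum_n_R_scal (c : R) (f : nat -> R) n : sum_n (fun k => c * f k) n = c * sum_n f n.
Proof. apply (sum_n_mult_l (K := R_Ring)). Qed.

Lemma sum_n_extend (g : nat -> R) n N :
  (n <= N)%nat -> (forall i, (n < i)%nat -> g i = 0) -> sum_n g N = sum_n g n.
Proof.
intros H Hg; induction H as [|N H IH]; [reflexivity|].
rewrite sum_Sn, IH, Hg by lia; apply Rplus_0_r.
Qed.

Lemma sum_n_if_eq (f : nat -> R) s m N : (m <= N)%nat ->
  sum_n (fun k => if (k + s =? m)%nat then f k else 0) N
  = if (s <=? m)%nat then f (m - s)%nat else 0.
Proof.
intros H; destruct (Nat.leb_spec s m) as [L|L].
- assert (G : forall M, sum_n (fun k => if (k + s =? m)%nat then f k else 0) M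
      = if (m - s <=? M)%nat then f (m - s)%nat else 0).
  { induction M as [|M IH].
    - rewrite sum_O; destruct (Nat.eqb_spec (0 + s) m), (Nat.leb_spec (m - s) 0); try lia; try reflexivity.
      f_equal; lia.
    - rewrite sum_n_R_S, IH.
      destruct (Nat.eqb_spec (S M + s) m), (Nat.leb_spec (m - s) M), (Nat.leb_spec (m - s) (S M));
        try lia; try ring_R.
      replace (m - s)%nat with (S M) by lia; ring_R. }
  rewrite G; destruct (Nat.leb_spec (m - s) N); [reflexivity|lia].
- rewrite (sum_n_extend _ 0).
  + rewrite sum_O; destruct (Nat.eqb_spec (0 + s) m); [lia|reflexivity].
  + lia.
  + intros i Hi; destruct (Nat.eqb_spec (i + s) m); [lia|reflexivity].
Qed.

(** One layer of a tuple sum: m is the prescribed total and s the part already used. The guards keep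
    truncated subtraction harmless. *)
Lemma sum_n_if_mul (x : R) (a b : nat -> R) s m N : (m <= N)%nat ->
  sum_n (fun k => if (k + s <=? m)%nat then x * (a k * b (m - (k + s))%nat) else 0) N
  = if (s <=? m)%nat then x * fps_mul a b (m - s)%nat else 0.
Proof.
intros H; destruct (Nat.leb_spec s m) as [L|L].
- rewrite (sum_n_extend _ (m - s)).
  + unfold fps_mul, PS_mult; rewrite <- sum_n_Reals.
    rewrite <- sum_n_R_scal.
    apply sum_n_ext_loc; intros k Hk; destruct (Nat.leb_spec (k + s) m); [|lia].
    replace (m - (k + s))%nat with (m - s - k)%nat by lia; reflexivity.
  + lia.
  + intros i Hi; destruct (Nat.leb_spec (i + s) m); [lia|reflexivity].
- rewrite (sum_n_extend _ 0).
  + rewrite sum_O; destruct (Nat.leb_spec (0 + s) m); [lia|reflexivity].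
  + lia.
  + intros i Hi; destruct (Nat.leb_spec (i + s) m); [lia|reflexivity].
Qed.

Lemma Hcoef_prod k1 k2 k3 k4 :
  Hcoef k1 k2 k3 k4 = fps_scale 2 (bell_egf xC) k1 * (bell_egf xD k2 * (bell_egf xD k3 * fps_pow_2 k4)).
Proof.
unfold Hcoef, fps_scale, fps_pow_2, bell_egf.
change (bellY xC k1) with (Cseq k1); change (bellY xD k2) with (Dseq k2); change (bellY xD k3) with (Dseq k3).
replace (-2 * ln 2) with (-1 * 2 * ln 2) by ring_R.
rewrite !Rpow_mult_distr, pow_add; field; repeat split; apply INR_fact_neq_0.
Qed.

(** The offset t absorbs the indices k5 and k6, and z the zeta factors, so that one lemma serves all
    three tuple sums. *)
Lemma sum4_Hcoef (cond : nat -> nat -> nat -> nat -> bool) (f : nat -> nat -> nat -> nat -> R) t m N z :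
  (m <= N)%nat ->
  (forall k1 k2 k3 k4, cond k1 k2 k3 k4 = (k1 + k2 + k3 + k4 + t =? m)%nat) ->
  (forall k1 k2 k3 k4, f k1 k2 k3 k4 = z * Hcoef k1 k2 k3 k4) ->
  sum4 N cond f = if (t <=? m)%nat then z * Bser (m - t)%nat else 0.
Proof.
intros Hm Hc Hf; unfold sum4, Bser.
rewrite <- (sum_n_if_mul z _ _ t m N Hm); apply sum_n_ext; intros k1.
transitivity (if (k1 + t <=? m)%nat then (z * fps_scale 2 (bell_egf xC) k1) *
   fps_mul (bell_egf xD) (fps_mul (bell_egf xD) fps_pow_2) (m - (k1 + t))%nat else 0);
  [|destruct (k1 + t <=? m)%nat; ring_R].
rewrite <- (sum_n_if_mul (z * fps_scale 2 (bell_egf xC) k1) _ _ (k1 + t) m N Hm); apply sum_n_ext; intros k2.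
transitivity (if (k2 + (k1 + t) <=? m)%nat then (z * fps_scale 2 (bell_egf xC) k1 * bell_egf xD k2) *
   fps_mul (bell_egf xD) fps_pow_2 (m - (k2 + (k1 + t)))%nat else 0);
  [|destruct (k2 + (k1 + t) <=? m)%nat; ring_R].
rewrite <- (sum_n_if_mul (z * fps_scale 2 (bell_egf xC) k1 * bell_egf xD k2) _ _ (k2 + (k1 + t)) m N Hm);
  apply sum_n_ext; intros k3.
rewrite <- (sum_n_if_eq (fun k4 => z * fps_scale 2 (bell_egf xC) k1 * bell_egf xD k2 * (bell_egf xD k3 * fps_pow_2 k4))
   (k3 + (k2 + (k1 + t))) m N Hm); apply sum_n_ext; intros k4.
rewrite Hc, Hf, Hcoef_prod.
replace (k4 + (k3 + (k2 + (k1 + t))))%nat with (k1 + k2 + k3 + k4 + t)%nat by lia.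
destruct (_ =? m)%nat; ring_R.
Qed.

(** The series (1 - pi s cot(pi s)) / 2. *)
Definition Zser : nat -> R := fun n =>
  if (n =? 0)%nat then 0 else if Nat.even n then zeta n else 0.

Lemma Wser_Zser : Wser = fps_sub fps1 (fps_add Zser Zser).
Proof.
extensionality n; unfold Wser, fps_sub, fps_add, fps1, Zser.
destruct (n =? 0)%nat, (Nat.even n); ring_R.
Qed.

Lemma sum_n_pairs (g : nat -> R) N :
  sum_n g (2 * N + 1) = sum_n (fun k => g (2 * k)%nat + g (2 * k + 1)%nat) N.
Proof.
induction N as [|N IH].
- simpl; rewrite sum_Sn, !sum_O; reflexivity.
- replace (2 * S N + 1)%nat with (S (S (2 * N + 1))) by lia.
  rewrite !sum_n_R_S, IH.
  replace (2 * S N)%nat with (S (2 * N + 1)) by lia.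
  replace (S (2 * N + 1) + 1)%nat with (S (S (2 * N + 1))) by lia; ring_R.
Qed.

(** The zeta index 2k + 2 leaves degree q + 1 - (2k + 2) for [a]. The bound N is kept apart from q
    because in [sum6] the inner sum runs further than its own total. *)
Lemma fps_mul_Zser (a : nat -> R) q N : (q <= N)%nat ->
  sum_n (fun k => if (2 * k + 1 <=? q)%nat then zeta (2 * k + 2) * a (q - (2 * k + 1))%nat else 0) N
  = fps_mul Zser a (q + 1).
Proof.
intros H; rewrite Nat.add_1_r, fps_mul_Sl.
replace (Zser 0) with 0 by reflexivity; rewrite Rmult_0_l, Rplus_0_l.
unfold fps_mul, PS_mult; rewrite <- sum_n_Reals.
transitivity (sum_n (fun i => if (i <=? q)%nat then fps_tail Zser i * a (q - i)%nat else 0) (2 * N + 1)).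
- rewrite sum_n_pairs; apply sum_n_ext; intros k.
  unfold fps_tail, Zser; simpl (S _ =? 0)%nat; cbv iota.
  replace (Nat.even (S (2 * k))) with false by (rewrite Nat.even_succ, Nat.odd_mul; reflexivity).
  replace (Nat.even (S (2 * k + 1))) with true
    by (replace (S (2 * k + 1)) with (2 * S k)%nat by lia; rewrite Nat.even_mul; reflexivity).
  replace (S (2 * k + 1)) with (2 * k + 2)%nat by lia.
  destruct (2 * k <=? q)%nat, (2 * k + 1 <=? q)%nat; ring_R.
- rewrite (sum_n_extend _ q).
  + apply sum_n_ext_loc; intros i Hi; destruct (Nat.leb_spec i q); [reflexivity|lia].
  + lia.
  + intros i Hi; destruct (Nat.leb_spec i q); [lia|reflexivity].
Qed.

Lemma sum5_Hcoef q :
  sum5 q (fun k1 k2 k3 k4 k5 => (k1 + k2 + k3 + k4 + 2 * k5 + 1 =? q)%nat)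
    (fun k1 k2 k3 k4 k5 => Hcoef k1 k2 k3 k4 * zeta (2 * k5 + 2))
  = fps_mul Zser Bser (q + 1).
Proof.
rewrite <- (fps_mul_Zser Bser q q (le_n q)); apply sum_n_ext; intros k5.
apply sum4_Hcoef; [lia| |intros; apply Rmult_comm].
intros k1 k2 k3 k4; f_equal; lia.
Qed.

Lemma sum6_Hcoef q :
  sum6 q (fun k1 k2 k3 k4 k5 k6 => (k1 + k2 + k3 + k4 + 2 * k5 + 2 * k6 + 3 =? q)%nat)
    (fun k1 k2 k3 k4 k5 k6 => Hcoef k1 k2 k3 k4 * zeta (2 * k5 + 2) * zeta (2 * k6 + 2))
  = fps_mul Zser (fps_mul Zser Bser) (q + 1).
Proof.
rewrite <- (fps_mul_Zser (fps_mul Zser Bser) q q (le_n q)); apply sum_n_ext; intros k6.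
transitivity (sum_n (fun k5 => if (2 * k5 + 2 * k6 + 3 <=? q)%nat
   then zeta (2 * k6 + 2) * zeta (2 * k5 + 2) * Bser (q - (2 * k5 + 2 * k6 + 3))%nat else 0) q).
{ apply sum_n_ext; intros k5.
  apply sum4_Hcoef; [lia| |intros; ring_R].
  intros k1 k2 k3 k4; f_equal; lia. }
destruct (Nat.leb_spec (2 * k6 + 2) q) as [L|L].
- destruct (Nat.leb_spec (2 * k6 + 1) q); [|lia].
  replace (q - (2 * k6 + 1))%nat with (q - (2 * k6 + 2) + 1)%nat by lia.
  rewrite <- (fps_mul_Zser Bser (q - (2 * k6 + 2)) q) by lia.
  rewrite <- sum_n_R_scal; apply sum_n_ext; intros k5.
  replace (q - (2 * k6 + 2) - (2 * k5 + 1))%nat with (q - (2 * k5 + 2 * k6 + 3))%nat by lia.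
  destruct (Nat.leb_spec (2 * k5 + 2 * k6 + 3) q), (Nat.leb_spec (2 * k5 + 1) (q - (2 * k6 + 2)));
    try lia; ring_R.
(* No k5 is admissible here. If q = 2 k6 + 1, the right side contains the constant coefficient of Z
   B, which is 0. *)
- rewrite (sum_n_extend _ 0).
  + rewrite sum_O; destruct (Nat.leb_spec (2 * 0 + 2 * k6 + 3) q); [lia|].
    destruct (Nat.leb_spec (2 * k6 + 1) q); [|reflexivity].
    replace (q - (2 * k6 + 1))%nat with 0%nat by lia.
    rewrite fps_mul_0; unfold Zser; simpl; ring_R.
  + lia.
  + intros k5 Hk; destruct (Nat.leb_spec (2 * k5 + 2 * k6 + 3) q); [lia|reflexivity].
Qed.

(* The constraints "= q - 1" and "= q - 3" are written with the constant added
   on the left, since subtraction on nat is truncated. *)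
Theorem theorem3p7 : forall q : nat, (1 <= q)%nat ->
  is_series1
    (fun n => harmonic (2 * n) * central_binom n / (4 ^ n * INR n ^ q))
    (ln 2 * bS q + INR q / 2 * bS (q + 1) + bS1 q
     + (-1) ^ q / 2 * bSt (q + 1)
     - / 2 * sum4 (q + 1)
               (fun k1 k2 k3 k4 => (k1 + k2 + k3 + k4 =? q + 1)%nat)
               (fun k1 k2 k3 k4 => Hcoef k1 k2 k3 k4)
     + 2 * sum5 q
             (fun k1 k2 k3 k4 k5 =>
                (k1 + k2 + k3 + k4 + 2 * k5 + 1 =? q)%nat)
             (fun k1 k2 k3 k4 k5 =>
                Hcoef k1 k2 k3 k4 * zeta (2 * k5 + 2))
     - 2 * sum6 q
             (fun k1 k2 k3 k4 k5 k6 =>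
                (k1 + k2 + k3 + k4 + 2 * k5 + 2 * k6 + 3 =? q)%nat)
             (fun k1 k2 k3 k4 k5 k6 =>
                Hcoef k1 k2 k3 k4 * zeta (2 * k5 + 2) * zeta (2 * k6 + 2))).
Proof.
intros q Hq.
rewrite sum5_Hcoef, sum6_Hcoef.
rewrite (sum4_Hcoef _ _ 0 (q + 1) (q + 1) 1); [|lia|intros; now rewrite Nat.add_0_r|intros; ring].
rewrite Nat.sub_0_r; simpl (0 <=? q + 1)%nat; cbv iota.
(* W P = B W^2 with W = 1 - 2 Z is B - 4 Z B + 4 Z^2 B. The multiples by 4 are spelled as sums so
   that they unfold coefficientwise. *)
assert (HW : fps_mul Wser Sser = fps_add Bser (fps_add
    (fps_opp (fps_add (fps_mul Zser Bser) (fps_add (fps_mul Zser Bser) (fps_add (fps_mul Zser Bser) (fps_mul Zser Bser)))))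
    (fps_add (fps_mul Zser (fps_mul Zser Bser)) (fps_add (fps_mul Zser (fps_mul Zser Bser))
      (fps_add (fps_mul Zser (fps_mul Zser Bser)) (fps_mul Zser (fps_mul Zser Bser))))))).
{ rewrite <- Bser_Wser, Wser_Zser; ring. }
destruct q as [|p]; [lia|].
pose proof (is_series_beta_deriv_eval p) as H.
rewrite HW in H; unfold fps_add, fps_opp in H.
replace (S p + 1)%nat with (p + 2)%nat by lia.
(* H_(2n) b_n = B'(n) / 2 + H_n b_n + ln 2 b_n; the factor 1/2 turns the coefficients 1, -4, 4 into
   -1/2, 2, -2. *)
refine (is_series_R_ext _ _ _ _ (is_series_R_plus _ _ _ _ (is_series_R_plus _ _ _ _
   (is_series_R_scal (/ 2) _ _ H) (is_series_bS1 (S p) Hq)) (is_series_R_scal (ln 2) _ _ (is_series_bS (S p) Hq))) _ _).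
- intros n; cbv beta; unfold beta_deriv, beta; pose proof (INR_S_pos n).
  field; split; apply pow_nonzero; lra.
- field.
Qed.
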